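(* Let $T>0$ and $\mathbf W\in\mathscr C^\alpha([0,T],\mathbb R^M)$. Let $(\eta(\cdot,x),\dot\eta(\cdot,x))\in\mathscr D^{2\alpha}_{\mathbf W}([0,T],\mathscr L(\mathbb R^M,\mathbb R^D))$ for all $x\in\mathbb R^D$, and assume: (a) the maps $\mathbb R^D\to\mathscr D^{2\alpha}_{\mathbf W}([0,T],\mathscr L(\mathbb R^M,\mathbb R^D))$, $x\mapsto(\eta(\cdot,x),\dot\eta(\cdot,x))$, and $\eta:[0,T]\times\mathbb R^D\to\mathscr L(\mathbb R^M,\mathbb R^D)$ are continuous, and $\eta(t,\cdot)\in C^\infty(\mathbb R^D,\mathscr L(\mathbb R^M,\mathbb R^D))$ for every $t\in[0,T]$; (b) the map $\mathrm D_x\eta:[0,T]\times\mathbb R^D\to\mathscr L(\mathbb R^D,\mathscr L(\mathbb R^M,\mathbb R^D))$ is continuous and $\mathrm D_x\eta(t,\cdot)\in C^\infty(\mathbb R^D,\mathscr L(\mathbb R^D,\mathscr L(\mathbb R^M,\mathbb R^D)))$ for every $t\in[0,T]$; (c) the map $\mathbb R^D\to\mathscr D^{2\alpha}_{\mathbf W}([0,T],\mathscr L(\mathbb R^D,\mathscr L(\mathbb R^M,\mathbb R^D)))$, $x\mapsto\big(t\mapsto(\mathrm D_x\eta(t,x),(\mathrm D_x\eta(\cdot,x))'_t)\big)$ is (well defined and) continuous. Let $\eta_0:[0,T]\times\mathbb R^D\to\mathbb R^D$ be continuous with $\eta_0(t,\cdot)\in C^\infty(\mathbb R^D,\mathbb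 R^D)$ for all $t\in[0,T]$. For all $x\in\mathbb R^D$ define the controlled rough path $(H(\cdot,x),\dot H(\cdot,x))\in\mathscr D^{2\alpha}_{\mathbf W}([0,T],\mathbb R^D)$ by $$H(t,x):=H(0,x)+\int_0^t\eta_0(s,x)\,\mathrm ds+\int_0^t\eta(s,x)\,\mathrm d\mathbf W_s ,$$ and assume that $H(t,\cdot)\in C^\infty(\mathbb R^D,\mathbb R^D)$ for every $t\in[0,T]$ and that the maps $(t,x)\mapsto H(t,x)$, $\mathrm D_xH(t,x)$, $\mathrm D_x^2H(t,x)$, $\mathrm D_x^3H(t,x)$ are continuous. Let $(Y,Y')\in\mathscr D^{2\alpha}_{\mathbf W}([0,T],\mathbb R^D)$ be given by $$Y_t:=Y_0+\int_0^t\Upsilon_0(s)\,\mathrm ds+\int_0^t\Upsilon_s\,\mathrm d\mathbf W_s ,$$ where $\Upsilon_0:[0,T]\to\mathbb R^D$ is continuous and $(\Upsilon,\Upsilon')\in\mathscr D^{2\alpha}_{\mathbf W}([0,T],\mathscr L(\mathbb R^M,\mathbb R^D))$. Then, for all $t\in[0,T]$, $$\begin{aligned}H(t,Y_t)&=H(0,Y_0)+\int_0^t\big(\eta(s,Y_s)+\mathrm D_xH(s,Y_s)\Upsilon_s\big)\,\mathrm d\mathbf W_s+\int_0^t\big(\eta_0(s,Y_s)+\mathrm D_xH(s,Y_s)\Upsilon_0(s)\big)\,\mathrm ds\\&\quad+\int_0^t\mathrm D_x\eta(s,Y_s)Y'_s\,\mathrm d[\mathbf W]_s+\frac12\int_0^t\mathrm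 D_x^2H(s,Y_s)(Y'_s\otimes Y'_s)\,\mathrm d[\mathbf W]_s,\end{aligned}$$ where the last two integrals are understood in the Young sense. In particular, if $\mathbf W$ is weakly geometric, the two Young integrals vanish because $[\mathbf W]=0$.
   Context: Fix $\alpha\in(1/3,1/2]$. $\mathscr L(\mathbb V_1,\mathbb V_2)$ denotes linear maps between finite-dimensional Banach spaces; $X_{s,t}:=X_t-X_s$. $\mathscr C^\alpha([0,T],\mathbb V)$ is the set of pairs $\mathbf W=(W,\mathbb W)$, $W:[0,T]\to\mathbb V$, $\mathbb W:[0,T]^2\to\mathbb V\otimes\mathbb V$, with $\sup_{s<t}|W_{s,t}|/(t-s)^\alpha<\infty$, $\sup_{s<t}|\mathbb W_{s,t}|/(t-s)^{2\alpha}<\infty$ and Chen's relation $W_{s,u}\otimes W_{u,t}=\mathbb W_{s,t}-\mathbb W_{s,u}-\mathbb W_{u,t}$ for $s<u<t$. With $2\mathrm{Sym}(\mathbb X)=\mathbb X+\mathbb X^T$, the bracket of $\mathbf W$ is $[\mathbf W]_{s,t}:=W_{s,t}\otimes W_{s,t}-2\mathrm{Sym}(\mathbb W_{s,t})$ (additive in $(s,t)$ and $2\alpha$-Hölder); $\mathbf W$ is weakly geometric if $\mathrm{Sym}(\mathbb W_{s,t})=\frac12W_{s,t}\otimes W_{s,t}$ for all $s<t$. Young integrals against $[\mathbf W]$ are limits of $\sum_{[u,v]}f_u[\mathbf W]_{u,v}$ with $f$ valued in $\mathscr L(\mathbb R^M\otimes\mathbb R^M,\mathbb R^D)$. $\mathscr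 D^{2\alpha}_{\mathbf W}([0,T],\mathbb V_2)$, for $\mathbf W\in\mathscr C^\alpha([0,T],\mathbb V_1)$, is the set of pairs $(Y,Y')$ with $Y\in C^\alpha([0,T],\mathbb V_2)$, $Y'\in C^\alpha([0,T],\mathscr L(\mathbb V_1,\mathbb V_2))$ (Gubinelli derivative) and $\mathfrak R_{s,t}:=Y_{s,t}-Y'_sW_{s,t}$ satisfying $\|\mathfrak R\|_{2\alpha}=\sup_{s<t}|\mathfrak R_{s,t}|/(t-s)^{2\alpha}<\infty$; it carries the semi-norm $\|Y'\|_\alpha+\|\mathfrak R\|_{2\alpha}$. The controlled integral is $\int_s^tY_r\,\mathrm d\mathbf W_r=\lim_{|\mathrm P|\to0}\sum_{[u,v]\in\mathrm P}Y_uW_{u,v}+Y'_u\mathbb W_{u,v}$, where $Y'_u(v\otimes w)=(Y'_uv)w$; the path $\int_0^\cdot Y\,\mathrm d\mathbf W$ is controlled with Gubinelli derivative $Y$. Hence $\dot H(\cdot,x)=\eta(\cdot,x)$ and $Y'=\Upsilon$. A dot or $(\cdot)'_t$ denotes the Gubinelli derivative of the time-path for fixed $x$; in particular $(\mathrm D_xH(\cdot,x))'=\mathrm D_x\eta(\cdot,x)$, i.e. $\big((\mathrm D_xH(\cdot,x))'_sv\big)y=(\mathrm D_x\eta(s,x)y)v$ for $v\in\mathbb R^M,y\in\mathbb R^D$. The integrand $\eta(s,Y_s)+\mathrm D_xH(s,Y_s)\Upsilon_s$ is a controlled rough path with Gubinelli derivative given by the chain and product rules: $\eta(\cdot,Y)$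 has derivative $\dot\eta(s,Y_s)+\mathrm D_x\eta(s,Y_s)Y'_s$, and $\mathrm D_xH(\cdot,Y)\Upsilon$ has derivative $(\mathrm D_xH(\cdot,Y_s))'_s\Upsilon_s+\mathrm D_x^2H(s,Y_s)(Y'_s\otimes\Upsilon_s)+\mathrm D_xH(s,Y_s)\Upsilon'_s$ (the first factor of $\mathbb W$ is paired with the direction of the Gubinelli derivative). $\mathrm D_x\eta(s,Y_s)Y'_s$ and $\mathrm D_x^2H(s,Y_s)(Y'_s\otimes Y'_s)$ are regarded as elements of $\mathscr L(\mathbb R^M\otimes\mathbb R^M,\mathbb R^D)$ via $v\otimes w\mapsto(\mathrm D_x\eta(s,Y_s)[Y'_sv])w$ and $v\otimes w\mapsto\mathrm D^2_xH(s,Y_s)(Y'_sv,Y'_sw)$.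
   Formalization: It is additionally assumed that η(·,Y) and D_xH(·,Y)Υ are controlled with the stated Gubinelli derivatives and that D_xη(·,Y)Y' and D_x²H(·,Y)(Y'⊗Y') are α-Hölder; (a)–(c) do not imply this, and without it the integrals may fail to exist. *)

(* Defs.v *)
From HB Require Import structures.
From mathcomp Require Export all_boot all_order all_algebra.
From mathcomp Require Export all_classical all_reals all_analysis.
Export Order.TTheory GRing.Theory Num.Theory.
Export numFieldNormedType.Exports.

Set Implicit Arguments.
Unset Strict Implicit.
Unset Printing Implicit Defensive.

Local Open Scope classical_set_scope.
Local Open Scope ring_scope.

(* Conventions.  R^n is 'cV[R]_n and L(R^M, R^D) is 'M[R]_(D, M), acting by *m.
   Linear maps into any other space are functions together with a linearity
   hypothesis.  R^M (x) R^M is 'M[R]_M, and an element of L(R^M (x) R^M, R^D)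
   is the corresponding bilinear function of two vectors.  Paths are functions
   on all of R, constrained on [0, T] only. *)

Section Calculus.
Context {R : realType} {V W : normedModType R}.

(* iterdiff f [:: v1; ...; vk] x = D^k f (x) (v1, ..., vk), where v1 is the
   direction of the last differentiation. *)
Fixpoint iterdiff (f : V -> W) (vs : seq V) : V -> W :=
  if vs is v :: vs' then fun x => 'd (iterdiff f vs') x v else f.

(* For finite-dimensional V, a map into L(V, W) is differentiable (continuous)
   iff its evaluation at each vector is, so this is C^oo. *)
Definition smooth (f : V -> W) : Prop :=
  forall (vs : seq V) (x : V), differentiable (iterdiff f vs) x.

Definition jointly_continuous (T : R) (f : R -> V -> W) : Prop :=
  {within [set p : R * V | 0 <= p.1 <= T], continuous (fun p => f p.1 p.2)}.

End Calculus.

Section Norms.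
Context {R : realType}.

Definition enorm {V : normedModType R} (v : V) : \bar R := (`|v|)%:E.

Definition opnorm {U : normedModType R} {V : Type} (N : V -> \bar R)
    (f : U -> V) : \bar R :=
  ereal_sup [set N (f u) | u in [set u : U | `|u| <= 1]].

Definition incr {V : zmodType} (X : R -> V) (s t : R) : V := X t - X s.

Definition holder {V : Type} (T a : R) (N : V -> \bar R) (Z : R -> R -> V) :
    \bar R :=
  ereal_sup [set (N (Z p.1 p.2) * (((p.2 - p.1) `^ a)^-1)%:E)%E
            | p in [set p : R * R | 0 <= p.1 /\ p.1 < p.2 /\ p.2 <= T]].

End Norms.

Section RoughPaths.
Context {R : realType} {M : nat}.
Variables (T alpha : R).

Definition tensor (v w : 'cV[R]_M) : 'M[R]_M := v *m w^T.

(* The linear extension of v (x) w |-> b v w to all tensors. *)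
Definition tapply {D : nat} (b : 'cV[R]_M -> 'cV[R]_M -> 'cV[R]_D)
    (X : 'M[R]_M) : 'cV[R]_D :=
  \sum_i \sum_j X i j *: b (delta_mx i 0) (delta_mx j 0).

Definition rough_path (W : R -> 'cV[R]_M) (WW : R -> R -> 'M[R]_M) : Prop :=
  [/\ (holder T alpha enorm (incr W) < +oo)%E,
      (holder T (2 * alpha) enorm WW < +oo)%E &
      forall s u t, 0 <= s -> s < u -> u < t -> t <= T ->
        tensor (incr W s u) (incr W u t) = WW s t - WW s u - WW u t].

Definition sym (X : 'M[R]_M) : 'M[R]_M := 2^-1 *: (X + X^T).

Definition bracket (W : R -> 'cV[R]_M) (WW : R -> R -> 'M[R]_M) (s t : R) : 'M[R]_M :=
  tensor (incr W s t) (incr W s t) - 2 *: sym (WW s t).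

Definition weakly_geometric (W : R -> 'cV[R]_M) (WW : R -> R -> 'M[R]_M) : Prop :=
  forall s t, 0 <= s -> s < t -> t <= T ->
    sym (WW s t) = 2^-1 *: tensor (incr W s t) (incr W s t).

Section Controlled.
(* N is the norm of V: enorm, or opnorm enorm when V is a space of maps. *)
Context {V : lmodType R}.
Variable N : V -> \bar R.

Definition remainder (W : R -> 'cV[R]_M) (Y : R -> V) (Y' : R -> 'cV[R]_M -> V)
    (s t : R) : V := incr Y s t - Y' s (incr W s t).

Definition controlled (W : R -> 'cV[R]_M) (Y : R -> V)
    (Y' : R -> 'cV[R]_M -> V) : Prop :=
  [/\ (forall t, 0 <= t <= T -> linear (Y' t)),
      (holder T alpha N (incr Y) < +oo)%E,
      (holder T alpha (opnorm N) (incr Y') < +oo)%E &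
      (holder T (2 * alpha) N (remainder W Y Y') < +oo)%E].

Definition controlled_seminorm (W : R -> 'cV[R]_M) (Y : R -> V)
    (Y' : R -> 'cV[R]_M -> V) : \bar R :=
  (holder T alpha (opnorm N) (incr Y') +
   holder T (2 * alpha) N (remainder W Y Y'))%E.

Definition continuous_controlled {X : topologicalType} (W : R -> 'cV[R]_M)
    (Y : R -> X -> V) (Y' : R -> X -> 'cV[R]_M -> V) : Prop :=
  forall x0 : X,
    controlled_seminorm W (fun t => Y t x - Y t x0)
                          (fun t => Y' t x - Y' t x0) @[x --> x0] --> 0%E.

End Controlled.

(* I is the limit of sum_[u,v] Xi u v over the partitions of [a, b] as the
   mesh tends to 0. *)
Definition is_partition_limit {V : normedModType R} (a b : R)
    (Xi : R -> R -> V) (I : V) : Prop :=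
  forall e, 0 < e -> exists2 d, 0 < d &
    forall s : seq R, itv_partition a b s ->
      all (fun l => l < d) (pairmap (fun u v => v - u) a s) ->
      `|\sum_(x <- pairmap Xi a s) x - I| < e.

(* Y'_u (v (x) w) = (Y'_u v) w *)
Definition is_rough_integral {D : nat}
    (W : R -> 'cV[R]_M) (WW : R -> R -> 'M[R]_M)
    (Y : R -> 'M[R]_(D, M))
    (Y' : R -> 'cV[R]_M -> 'M[R]_(D, M)) (a b : R) (I : 'cV[R]_D) : Prop :=
  is_partition_limit a b
    (fun u v => Y u *m incr W u v + tapply (fun x y => Y' u x *m y) (WW u v)) I.

Definition is_young_integral {D : nat}
    (W : R -> 'cV[R]_M) (WW : R -> R -> 'M[R]_M)
   
    (f : R -> 'cV[R]_M -> 'cV[R]_M -> 'cV[R]_D) (a b : R) (I : 'cV[R]_D) : Prop :=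
  is_partition_limit a b (fun u v => tapply (f u) (bracket W WW u v)) I.

(* alpha-Hoelder integrands, in operator norm: the class on which Young integration against the
   2 alpha-Hoelder path [W] is defined, since 3 alpha > 1. *)
Definition young_integrand {D : nat}
    (f : R -> 'cV[R]_M -> 'cV[R]_M -> 'cV[R]_D) : Prop :=
  (holder T alpha (opnorm (opnorm enorm)) (incr f) < +oo)%E.

End RoughPaths.

Section Integrands.
Context {R : realType} {M D : nat}.

Definition time_integral (a b : R) (f : R -> 'cV[R]_D) : 'cV[R]_D :=
  \col_i \int[lebesgue_measure]_(s in `[a, b]) f s i 0.

Definition mx_of (f : 'cV[R]_M -> 'cV[R]_D) : 'M[R]_(D, M) :=
  \matrix_(i, j) f (delta_mx j 0) i 0.

Variables (eta : R -> 'cV[R]_D -> 'M[R]_(D, M))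
          (etadot : R -> 'cV[R]_D -> 'cV[R]_M -> 'M[R]_(D, M))
          (H : R -> 'cV[R]_D -> 'cV[R]_D)
          (Y : R -> 'cV[R]_D)
          (Ups : R -> 'M[R]_(D, M))
          (Ups' : R -> 'cV[R]_M -> 'M[R]_(D, M)).

(* Membership of (eta_Y, eta_Y'), (DH_Ups, DH_Ups') in D^{2 alpha}_W and the
   Hoelder regularity of Deta_Y', D2H_Y'Y' are not automatic: smoothness of
   eta (t, .) for each t bounds no second x-derivative uniformly in t.  For
   W = 0, WW s t = g t - g s, eta may oscillate in x ever faster as t -> 0, and
   the Riemann sums of D_x eta (s, Y_s) against g need not converge. *)
Definition eta_Y (s : R) : 'M[R]_(D, M) := eta s (Y s).

Definition eta_Y' (s : R) (v : 'cV[R]_M) : 'M[R]_(D, M) :=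
  etadot s (Y s) v + 'd (eta s) (Y s) (Ups s *m v).

Definition DH_Ups (s : R) : 'M[R]_(D, M) :=
  mx_of (fun w => 'd (H s) (Y s) (Ups s *m w)).

(* The first summand is the Gubinelli derivative of D_x H (., x), namely
   ((D_x H (., x))'_s v) y = (D_x eta (s, x) y) v, at y = Ups s *m w. *)
Definition DH_Ups' (s : R) (v : 'cV[R]_M) : 'M[R]_(D, M) :=
  mx_of (fun w => 'd (eta s) (Y s) (Ups s *m w) *m v
                  + iterdiff (H s) [:: Ups s *m v; Ups s *m w] (Y s)
                  + 'd (H s) (Y s) (Ups' s v *m w)).

Definition Deta_Y' (s : R) (v w : 'cV[R]_M) : 'cV[R]_D :=
  'd (eta s) (Y s) (Ups s *m v) *m w.

Definition D2H_Y'Y' (s : R) (v w : 'cV[R]_M) : 'cV[R]_D :=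
  iterdiff (H s) [:: Ups s *m v; Ups s *m w] (Y s).

End Integrands.

(* Main.v *)
From HB Require Import structures.
Require Import Defs.
From mathcomp Require Import ring lra.

(** The two sides are compared through Riemann sums. Write w for the increment
of W over [u, v], X for the second level WW u v, k = Y'_u w, and let p be
(v - u)^alpha, so that p^3 = o(v - u) because alpha > 1/3. The increment of
H(t, Y_t) over [u, v] is split as

  [H(u, Y_v) - H(u, Y_u)] + [H(v, Y_v) - H(u, Y_v)].

Moving the space variable first makes every spatial derivative of H appear at
the left endpoint u; the opposite order would require a rate for the time
increments of D_x^2 H, and only continuity is available.

The first bracket is expanded to third order (taylor3):
D_x H(h) + D_x^2 H(h, h) / 2 + O(p^3) at (u, Y_u), with h = Y_v - Y_u. There
D_x^2 H(h, h) is replaced by D_x^2 H(k, k), as h = k + O(p^2), and D_x H(h) is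
expanded with the integral defining Y.

The second bracket is an increment of the integral defining H(., x) at the
frozen point x = Y_v. The sewing lemma (sewing_bound) gives
(v - u) eta0 + eta(u, Y_v) w + etadot(u, Y_v) X + O(p^3), uniformly in v since
the seminorm of eta(., x) is continuous in x and Y([0, T]) is compact. It
remains to replace Y_v by Y_u. The assumed regularity of eta(., Y) and of
D_x eta(., Y) Y' makes s |-> etadot(s, Y_s) alpha-Hoelder
(etadot_space_holder), which settles the X term and, compared with the
controlled expansions of eta(., Y) and of eta(., Y_v), yields
eta(u, Y_v) - eta(u, Y_u) = D_x eta(u, Y_u) k + O(p^2).

Altogether the increment of H(t, Y_t) is, up to o(v - u) (negligible),

  (v - u) (eta0 + D_x H Ups0) + (eta + D_x H Ups) w + etadot X + D_x H (Ups' X)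
    + (D_x eta k) w + D_x^2 H(k, k) / 2.

The germ of the rough integral in the formula contains in addition
D_x eta (v) w + D_x eta (w) v + D_x^2 H (v, w) contracted with X. The bracket
germs trade exactly these for the last line, because [W] = w w^T - X - X^T and
D_x^2 H is symmetric (second_derivative_symmetric, composed_germE). Existence
of the three integrals is sewing_limit, and limits of Riemann sums add up. *)

Set Implicit Arguments.
Unset Strict Implicit.
Unset Printing Implicit Defensive.

Local Open Scope classical_set_scope.
Local Open Scope ring_scope.


(** * Riemann sums and the sewing lemma *)

Section RiemannSums.
Context {R : realType} {V : zmodType}.
Implicit Types (Xi : R -> R -> V) (a b : R) (s : seq R).

Definition riemann_sum Xi a s : V := \sum_(x <- pairmap Xi a s) x.

Definition mesh_lt (d a : R) s :=
  all (fun l => l < d) (pairmap (fun u v => v - u) a s).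

Lemma riemann_sum_nil Xi a : riemann_sum Xi a [::] = 0.
Proof. by rewrite /riemann_sum big_nil. Qed.

Lemma riemann_sum_cons Xi a x s :
  riemann_sum Xi a (x :: s) = Xi a x + riemann_sum Xi x s.
Proof. by rewrite /riemann_sum /= big_cons. Qed.

Lemma riemann_sum_cat Xi a s1 s2 :
  riemann_sum Xi a (s1 ++ s2) =
  riemann_sum Xi a s1 + riemann_sum Xi (last a s1) s2.
Proof. by rewrite /riemann_sum pairmap_cat big_cat. Qed.

Lemma mesh_lt_cat d a s1 s2 :
  mesh_lt d a (s1 ++ s2) = mesh_lt d a s1 && mesh_lt d (last a s1) s2.
Proof. by rewrite /mesh_lt pairmap_cat all_cat. Qed.

Lemma mesh_ltW d d' a s : d <= d' -> mesh_lt d a s -> mesh_lt d' a s.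
Proof. by move=> dd'; apply: sub_all => x /lt_le_trans; apply. Qed.

Lemma riemann_sum_telescope (f : R -> V) a s :
  riemann_sum (fun u v => f v - f u) a s = f (last a s) - f a.
Proof.
elim: s a => [|x s IH] a; first by rewrite riemann_sum_nil subrr.
by rewrite riemann_sum_cons IH /= addrC addrA subrK.
Qed.

Lemma riemann_sumD Xi Xi' a s :
  riemann_sum (fun u v => Xi u v + Xi' u v) a s =
  riemann_sum Xi a s + riemann_sum Xi' a s.
Proof.
elim: s a => [|x s IH] a; first by rewrite !riemann_sum_nil addr0.
by rewrite !riemann_sum_cons IH addrACA.
Qed.

Lemma path_lt_last a s : path <%O a s -> all (fun x => x <= last a s) (a :: s).
Proof.
elim: s a => [|x s IH] a /=; first by rewrite lexx.
by move=> /andP[ax /IH/=/andP[xl ->]]; rewrite xl (le_trans (ltW ax) xl).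
Qed.

Lemma path_lt_last_le a s : path <%O a s -> a <= last a s.
Proof. by move=> /path_lt_last /andP[]. Qed.

Lemma path_lt_size a s : path <%O a s -> last a s = a -> s = [::].
Proof.
case: s => //= x s /andP[ax /path_lt_last_le] /[swap] ->.
by move=> /(lt_le_trans ax); rewrite ltxx.
Qed.

Lemma path_straddle a m s : a <= m -> m < last a s ->
  exists s1 x s2, [/\ s = s1 ++ x :: s2, last a s1 <= m & m < x].
Proof.
elim: s a => [|y s IH] a am mb; first by move: am; rewrite leNgt mb.
have [ym|my] := leP y m; last by exists [::], y, s.
have [s1 [x [s2 [-> ? ?]]]] := IH y ym mb.
by exists (y :: s1), x, s2.
Qed.

Lemma fine_partition a b d : a <= b -> 0 < d ->
  exists2 s, itv_partition a b s & mesh_lt d a s.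
Proof.
move=> ab d0.
have d20 : 0 < d / 2 by lra.
have [n] : exists n : nat, b - a < n%:R * (d / 2).
  exists (Num.bound ((b - a) / (d / 2))).
  by rewrite -ltr_pdivrMr// archi_boundP// divr_ge0//; lra.
elim: n a ab => [|n IH] a ab; first by rewrite mul0r subr_lt0 ltNge ab.
rewrite -natr1 mulrDl mul1r => abn.
have [small|big] := ltP (b - a) d.
  move: ab; rewrite le_eqVlt => /predU1P[->|ab].
    by exists [::]; rewrite /itv_partition /=.
  by exists [:: b]; [exact: itv_partition1|rewrite /mesh_lt /= small].
have [||s [ps ls] ms] := IH (a + d / 2); [lra|lra|].
exists ((a + d / 2) :: s); first by rewrite /itv_partition /= ltrDl d20 ps.
by apply/andP; split=> //=; lra.
Qed.

End RiemannSums.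

Section Sewing.
Context {R : realType} {V : normedModType R}.
Implicit Types (Xi : R -> R -> V) (a b : R) (s : seq R).

Lemma riemann_sum_mesh_le Xi (c d : R) a s :
  path <%O a s -> mesh_lt d a s ->
  (forall u v, a <= u -> u < v -> v <= last a s -> v - u < d ->
     `|Xi u v| <= c * (v - u)) ->
  `|riemann_sum Xi a s| <= c * (last a s - a).
Proof.
elim: s a => [|x s IH] a /=.
  by rewrite riemann_sum_nil normr0 subrr mulr0.
move=> /andP[ax ps] /andP[xd ms] Xig; rewrite riemann_sum_cons.
apply: le_trans (ler_normD _ _) _.
rewrite (_ : c * _ = c * (x - a) + c * (last x s - x)); last by ring.
apply: lerD.
  by apply: Xig => //; exact: path_lt_last_le.
by apply: IH => // u v xu; apply: Xig; exact: le_trans (ltW ax) xu.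
Qed.

(** For theta > 1 the defect of additivity is too small to accumulate in
Riemann sums, so that the germ Xi integrates to an additive function. *)
Definition almost_additive (T theta K : R) Xi :=
  forall r u t, 0 <= r -> r < u -> u < t -> t <= T ->
    `|Xi r t - Xi r u - Xi u t| <= K * (t - r) `^ theta.

Definition sewing_const (theta : R) : R := 2 / (1 - 2 * 2^-1 `^ theta).

Lemma half_powR_lt (theta : R) : 1 < theta -> 2 * 2^-1 `^ theta < 1 :> R.
Proof.
move=> th; rewrite -ltr_pdivlMl// mulr1 -[ltRHS]powRr1 ?invr_ge0//.
rewrite -subr_gt0 /powR; case: eqP => [|_]; first lra.
rewrite subr_gt0 ltr_expR mul1r -subr_gt0.
have l2 : ln (2^-1 : R) < 0 by rewrite ln_lt0//; lra.
by rewrite -[X in X - _]mul1r -mulrBl nmulr_rgt0// subr_lt0.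
Qed.

Lemma sewing_const_ge0 (theta : R) : 1 < theta -> 0 <= sewing_const theta.
Proof.
move=> /half_powR_lt th; rewrite /sewing_const divr_ge0//; lra.
Qed.

(** Cut the partition at its subinterval containing the midpoint of [a, b]:
the two remaining pieces have length at most half of b - a, and
C = sewing_const theta solves 2 C 2^-theta + 2 = C. *)
Lemma sewing_bound (T theta K : R) Xi a s :
  1 < theta -> 0 <= K -> almost_additive T theta K Xi ->
  0 <= a -> path <%O a s -> last a s <= T -> s != [::] ->
  `|riemann_sum Xi a s - Xi a (last a s)|
    <= sewing_const theta * K * (last a s - a) `^ theta.
Proof.
move=> th K0 Xiadd.
(* A zero on the diagonal lets the two pieces be empty. *)
pose Z u v := if u == v then 0 else Xi u v.
have Zadd r u t : 0 <= r -> r <= u -> u <= t -> t <= T ->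
    `|Z r t - Z r u - Z u t| <= K * (t - r) `^ theta.
  move=> r0; rewrite le_eqVlt => /predU1P[->|ru].
    by rewrite /Z eqxx subr0 subrr normr0 mulr_ge0 ?powR_ge0.
  rewrite le_eqVlt => /predU1P[<-|ut] tT.
    by rewrite /Z eqxx subrr subr0 normr0 mulr_ge0 ?powR_ge0.
  rewrite /Z (lt_eqF ru) (lt_eqF ut) (lt_eqF (lt_trans ru ut)).
  exact: Xiadd.
suff main n a' s' : (size s' <= n)%N -> 0 <= a' -> path <%O a' s' ->
    last a' s' <= T -> `|riemann_sum Xi a' s' - Z a' (last a' s')|
    <= sewing_const theta * K * (last a' s' - a') `^ theta.
  move=> a0 ps lT s0; have := main _ _ _ (leqnn _) a0 ps lT.
  rewrite /Z; case: eqP => // alast.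
  by move/eqP: s0; rewrite (path_lt_size ps (esym alast)).
have CK0 : 0 <= sewing_const theta * K.
  by apply: mulr_ge0 => //; exact: sewing_const_ge0.
elim: n a' s' => [|n IH] {}a {}s.
  rewrite leqn0 => /nilP -> a0 _ _ /=.
  rewrite riemann_sum_nil /Z eqxx subr0 normr0.
  exact: mulr_ge0 CK0 (powR_ge0 _ _).
move=> sn a0 ps lT.
have [s0|s0] := eqVneq s [::].
  rewrite s0 riemann_sum_nil /= /Z eqxx subr0 normr0.
  exact: mulr_ge0 CK0 (powR_ge0 _ _).
set b := last a s in lT *.
have ab : a < b.
  rewrite lt_neqAle path_lt_last_le// andbT; apply/eqP => ab.
  by move/eqP: s0; rewrite (path_lt_size ps (esym ab)).
pose m := (a + b) / 2.
have am : a <= m by rewrite /m; lra.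
have mb : m < b by rewrite /m; lra.
have [s1 [x [s2 [es l1 mx]]]] := path_straddle am mb.
have bE : b = last x s2 by rewrite /b es last_cat.
move: ps; rewrite es cat_path /= => /and3P[ps1 l1x ps2].
have al1 := path_lt_last_le ps1.
have xb : x <= b by rewrite bE path_lt_last_le.
have sz : (size s1 + size s2 <= n)%N by move: sn; rewrite es size_cat /= addnS.
set c := last a s1 in l1 l1x al1 *.
have B1 := IH a s1 (leq_trans (leq_addr _ _) sz) a0 ps1.
have B2 := IH x s2 (leq_trans (leq_addl _ _) sz).
rewrite -/c in B1; rewrite -bE in B2.
have cT : c <= T by lra.
have x0 : 0 <= x by lra.
have {}B1 := B1 cT; have {}B2 := B2 x0 ps2 lT.
have A1 := Zadd a c x a0 al1 (ltW l1x) (le_trans xb lT).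
have A2 := Zadd a x b a0 (le_trans al1 (ltW l1x)) xb lT.
rewrite riemann_sum_cat riemann_sum_cons -/c.
have -> : riemann_sum Xi a s1 + (Xi c x + riemann_sum Xi x s2) - Z a b =
   (riemann_sum Xi a s1 - Z a c) + (riemann_sum Xi x s2 - Z x b)
   - (Z a x - Z a c - Z c x) - (Z a b - Z a x - Z x b).
  rewrite [Z c x]/Z (lt_eqF l1x) !opprB !addrA.
  by rewrite [RHS](ACl (1*5*3*10*(2*6)*(4*8)*(7*9)))/= !addNr !addr0.
set p := (b - a) `^ theta.
have half r : 0 <= r -> r <= (b - a) / 2 -> r `^ theta <= 2^-1 `^ theta * p.
  move=> r0 rh; rewrite /p mulrC -powRM; [|lra|lra].
  by apply: ge0_ler_powR => //; rewrite ?nnegrE; lra.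
have H1 : (c - a) `^ theta <= 2^-1 `^ theta * p by apply: half; rewrite /m in l1; lra.
have H2 : (b - x) `^ theta <= 2^-1 `^ theta * p by apply: half; rewrite /m in mx; lra.
have H3 : (x - a) `^ theta <= p by apply: ge0_ler_powR; rewrite ?nnegrE; lra.
have CE : sewing_const theta = 2 + 2 * 2^-1 `^ theta * sewing_const theta.
  rewrite /sewing_const; have := half_powR_lt th.
  by move=> ?; field; apply/eqP; lra.
have tri (x1 x2 x3 x4 : V) :
    `|x1 + x2 - x3 - x4| <= `|x1| + `|x2| + `|x3| + `|x4|.
  apply: le_trans (ler_normB _ _) _; rewrite lerD2r.
  by apply: le_trans (ler_normB _ _) _; rewrite lerD2r ler_normD.
apply: le_trans (tri _ _ _ _) _.
have {}B1 := le_trans B1 (ler_wpM2l CK0 H1).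
have {}B2 := le_trans B2 (ler_wpM2l CK0 H2).
have {}A1 := le_trans A1 (ler_wpM2l K0 H3).
rewrite -/p in A2; rewrite [in leRHS]CE.
have -> : (2 + 2 * 2^-1 `^ theta * sewing_const theta) * K * p =
  sewing_const theta * K * (2^-1 `^ theta * p) +
  sewing_const theta * K * (2^-1 `^ theta * p) + K * p + K * p by ring.
by apply: lerD => //; apply: lerD => //; apply: lerD.
Qed.

Lemma superlinear_le (theta d r : R) :
  1 < theta -> 0 < r -> r <= d -> r `^ theta <= d `^ (theta - 1) * r.
Proof.
move=> th r0 rd.
have -> : r `^ theta = r `^ (theta - 1) * r.
  rewrite -[X in _ = _ * X]powRr1 ?(ltW r0)// -powRD ?subrK//.
  by apply/implyP => _; rewrite gt_eqF.
apply: ler_wpM2r; first exact: ltW.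
by apply: ge0_ler_powR; rewrite ?nnegrE; lra.
Qed.

Lemma superlinear_small (theta e : R) : 1 < theta -> 0 < e ->
  exists2 d, 0 < d & forall r, 0 < r -> r < d -> r `^ theta <= e * r.
Proof.
move=> th e0; exists (e `^ (theta - 1)^-1); first exact: powR_gt0.
move=> r r0 rd; apply: le_trans (superlinear_le th r0 (ltW rd)) _.
by rewrite -powRrM mulVf ?powRr1 ?(ltW e0)//; lra.
Qed.

(** The fine partition subdivides each subinterval of the coarse one, where
[sewing_bound] compares the partial sum with the single germ. *)
Lemma riemann_sum_refine (T theta K : R) Xi a s r :
  1 < theta -> 0 <= K -> almost_additive T theta K Xi ->
  0 <= a -> path <%O a s -> path <%O a r -> last a s = last a r ->
  last a r <= T -> {subset s <= r} ->
  `|riemann_sum Xi a r - riemann_sum Xi a s| <=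
    riemann_sum (fun u v => sewing_const theta * K * (v - u) `^ theta) a s.
Proof.
move=> th K0 Xiadd; elim: s a r => [|x s IH] a r a0 /=.
  move=> _ pr alr _ _; rewrite (path_lt_size pr (esym alr)).
  by rewrite !riemann_sum_nil subrr normr0.
move=> /andP[ax ps] pr slr lT sr.
have xr : x \in r by apply: sr; rewrite mem_head.
move: pr slr lT sr; case/splitPr: xr => r1 r2.
rewrite cat_path last_cat /= => /and3P[pr1 l1x pr2] slr lT sr.
have sr2 : {subset s <= r2}.
  move=> y ys; have xy : x < y by have /allP := order_path_min lt_trans ps; apply.
  have := sr y; rewrite inE ys orbT mem_cat inE => /(_ isT) /or3P[yr1|/eqP yx|//].
    have /allP/(_ y) := path_lt_last pr1; rewrite inE yr1 orbT => /(_ isT) yl.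
    by have := lt_trans (le_lt_trans yl l1x) xy; rewrite ltxx.
  by move: xy; rewrite yx ltxx.
have x0 : 0 <= x by lra.
have B2 := IH x r2 x0 ps pr2 slr lT sr2.
have pr1x : path <%O a (rcons r1 x) by rewrite rcons_path pr1.
have xT : x <= T by apply: le_trans lT; exact: path_lt_last_le.
have B1 : `|riemann_sum Xi a (rcons r1 x) - Xi a x| <=
    sewing_const theta * K * (x - a) `^ theta.
  have := @sewing_bound T theta K Xi a (rcons r1 x) th K0 Xiadd a0 pr1x.
  by rewrite last_rcons; apply => //; case: (r1).
rewrite -cat_rcons riemann_sum_cat last_rcons !riemann_sum_cons.
rewrite [X in `|X|](_ : _ = (riemann_sum Xi a (rcons r1 x) - Xi a x) +
   (riemann_sum Xi x r2 - riemann_sum Xi x s)); last first.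
  by rewrite opprD addrACA.
by apply: le_trans (ler_normD _ _) _; apply: lerD.
Qed.

Lemma common_refinement a b s1 s2 :
  itv_partition a b s1 -> itv_partition a b s2 ->
  exists r, [/\ itv_partition a b r, {subset s1 <= r} & {subset s2 <= r}].
Proof.
move=> [p1 /eqP l1] [p2 /eqP l2].
pose r := sort <=%O (undup (s1 ++ s2)).
have mr x : (x \in r) = (x \in s1) || (x \in s2).
  by rewrite mem_sort mem_undup mem_cat.
have ar : all (fun x => a < x <= b) r.
  apply/allP => x; rewrite mr => /orP[] xs.
    have /allP/(_ x xs) -> := order_path_min lt_trans p1.
    by have /andP[_ /allP/(_ x xs)] := path_lt_last p1; rewrite l1.
  have /allP/(_ x xs) -> := order_path_min lt_trans p2.
  by have /andP[_ /allP/(_ x xs)] := path_lt_last p2; rewrite l2.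
have pr : path <%O a r.
  rewrite lt_path_sortedE; apply/andP; split.
    by apply: sub_all ar => x /andP[].
  by rewrite lt_sorted_uniq_le sort_uniq undup_uniq sort_le_sorted.
exists r; split; last by move=> x xs; rewrite mr xs orbT.
  split => //; apply/eqP/le_anti/andP; split.
    have := mem_last a r; rewrite inE => /predU1P[->|/(allP ar)/andP[]//].
    by rewrite -l1 path_lt_last_le.
  have := mem_last a s1; rewrite l1 inE => /predU1P[->|bs].
    exact: path_lt_last_le.
  have /allP := path_lt_last pr; apply.
  by rewrite inE mr bs orbT.
by move=> x xs; rewrite mr xs.
Qed.

Lemma riemann_sum_superlinear (theta K d : R) a s :
  1 < theta -> 0 <= K -> path <%O a s -> mesh_lt d a s ->
  riemann_sum (fun u v => K * (v - u) `^ theta) a s <=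
    K * d `^ (theta - 1) * (last a s - a).
Proof.
move=> th K0; elim: s a => [|x s IH] a /=.
  by rewrite riemann_sum_nil subrr mulr0.
move=> /andP[ax ps] /andP[xd ms]; rewrite riemann_sum_cons.
rewrite (_ : K * _ * (_ - a) = K * (d `^ (theta - 1) * (x - a)) +
  K * d `^ (theta - 1) * (last x s - x)); last by ring.
apply: lerD; last exact: IH.
apply: ler_wpM2l => //; apply: superlinear_le => //; first by rewrite subr_gt0.
exact: ltW.
Qed.

Lemma riemann_sum_close (T theta K d : R) Xi a b s1 s2 :
  1 < theta -> 0 <= K -> almost_additive T theta K Xi ->
  0 <= a -> b <= T -> itv_partition a b s1 -> itv_partition a b s2 ->
  mesh_lt d a s1 -> mesh_lt d a s2 ->
  `|riemann_sum Xi a s1 - riemann_sum Xi a s2| <=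
    2 * (sewing_const theta * K * d `^ (theta - 1) * (b - a)).
Proof.
move=> th K0 Xiadd a0 bT P1 P2 m1 m2.
have [r [[pr /eqP lr] sr1 sr2]] := common_refinement P1 P2.
case: P1 P2 => p1 /eqP l1 [p2 /eqP l2].
have CK0 : 0 <= sewing_const theta * K.
  by apply: mulr_ge0 => //; exact: sewing_const_ge0.
have R1 := @riemann_sum_refine T theta K Xi a s1 r th K0 Xiadd a0 p1 pr.
have R2 := @riemann_sum_refine T theta K Xi a s2 r th K0 Xiadd a0 p2 pr.
rewrite l1 lr in R1; rewrite l2 lr in R2.
have {}R1 := R1 erefl bT sr1; have {}R2 := R2 erefl bT sr2.
have S1 := riemann_sum_superlinear th CK0 p1 m1.
have S2 := riemann_sum_superlinear th CK0 p2 m2.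
rewrite l1 in S1; rewrite l2 in S2.
have := ler_distD (riemann_sum Xi a r) (riemann_sum Xi a s1) (riemann_sum Xi a s2).
rewrite (distrC _ (riemann_sum Xi a r)); lra.
Qed.

(** Limits over adjacent intervals subtract: a fine partition of [0, u] extends
to a fine partition of [0, v], and the added part is controlled by
[sewing_bound]. *)
Lemma partition_limit_increment (T theta K : R) Xi (u v : R) (Iu Iv : V) :
  1 < theta -> 0 <= K -> almost_additive T theta K Xi ->
  0 <= u -> u < v -> v <= T ->
  is_partition_limit 0 u Xi Iu -> is_partition_limit 0 v Xi Iv ->
  `|Iv - Iu - Xi u v| <= sewing_const theta * K * (v - u) `^ theta.
Proof.
move=> th K0 Xiadd u0 uv vT limu limv; apply/ler_addgt0Pr => e e0.
have e20 : 0 < e / 2 by lra.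
have [d1 d10 H1] := limu _ e20; have [d2 d20 H2] := limv _ e20.
pose d := Num.min d1 d2.
have d0 : 0 < d by rewrite lt_min d10.
have [s1 P1 m1] := fine_partition u0 d0.
have [s2 P2 m2] := fine_partition (ltW uv) d0.
have P12 := itv_partition_cat P1 P2.
case: (P1) (P2) => p1 /eqP l1 [p2 /eqP l2].
have dd1 : d <= d1 by rewrite ge_min lexx.
have dd2 : d <= d2 by rewrite ge_min lexx orbT.
have m12 : mesh_lt d 0 (s1 ++ s2) by rewrite mesh_lt_cat m1 l1.
have {}H1 := H1 s1 P1 (mesh_ltW dd1 m1).
have {}H2 := H2 _ P12 (mesh_ltW dd2 m12).
have s20 : s2 != [::] by apply: contraTneq uv => s20; rewrite -l2 s20 ltxx.
have B := @sewing_bound T theta K Xi u s2 th K0 Xiadd u0 p2.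
rewrite l2 in B; have {}B := B vT s20.
rewrite -/(riemann_sum Xi 0 (s1 ++ s2)) riemann_sum_cat l1 in H2.
rewrite -/(riemann_sum Xi 0 s1) in H1.
have -> : Iv - Iu - Xi u v = (riemann_sum Xi 0 s1 - Iu) -
   (riemann_sum Xi 0 s1 + riemann_sum Xi u s2 - Iv) + (riemann_sum Xi u s2 - Xi u v).
  rewrite !opprD !opprK !addrA.
  by rewrite [RHS](ACl (5*2*7*(1*3)*(4*6)))/= subrr addNr !addr0.
apply: le_trans (ler_normD _ _) _; rewrite addrC; apply: lerD => //.
by apply: le_trans (ler_normB _ _) _; lra.
Qed.

End Sewing.

(** Two fine partitions have a common refinement, so the Riemann sums form a
Cauchy filter indexed by the mesh. *)
Lemma sewing_limit (R : realType) (m n : nat) (T theta K : R)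
    (Xi : R -> R -> 'M[R]_(m, n)) (b : R) :
  1 < theta -> 0 <= K -> almost_additive T theta K Xi -> 0 <= b -> b <= T ->
  exists I, is_partition_limit 0 b Xi I.
Proof.
move=> th K0 Xiadd b0 bT.
pose sums d := [set x | exists s,
  [/\ itv_partition 0 b s, mesh_lt d 0 s & x = riemann_sum Xi 0 s]].
pose F := filter_from [set d : R | 0 < d] sums.
have FF : ProperFilter F.
  apply: filter_from_proper.
    apply: filter_from_filter; first by exists 1; exact: ltr01.
    move=> d d' d0 d'0; exists (Num.min d d'); first by rewrite /= lt_min d0.
    move=> _ [s [Ps ms ->]]; split; exists s; split => //.
      by apply: mesh_ltW ms; rewrite ge_min lexx.
    by apply: mesh_ltW ms; rewrite ge_min lexx orbT.
  by move=> d d0; have [s Ps ms] := fine_partition b0 d0; exists (riemann_sum Xi 0 s), s.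
have close e : 0 < e -> exists2 d, 0 < d & forall s1 s2,
    itv_partition 0 b s1 -> itv_partition 0 b s2 -> mesh_lt d 0 s1 ->
    mesh_lt d 0 s2 -> `|riemann_sum Xi 0 s1 - riemann_sum Xi 0 s2| < e.
  move=> e0.
  pose A := 2 * (sewing_const theta * K * b) + 1.
  have A0 : 0 < A.
    rewrite /A ltr_wpDl//; do 3! apply: mulr_ge0 => //.
    exact: sewing_const_ge0.
  pose d := (e / A) `^ (theta - 1)^-1.
  have eA0 : 0 < e / A by rewrite divr_gt0.
  exists d; first exact: powR_gt0.
  move=> s1 s2 P1 P2 m1 m2.
  apply: le_lt_trans (riemann_sum_close th K0 Xiadd _ bT P1 P2 m1 m2) _ => //.
  rewrite /d -powRrM mulVf ?powRr1 ?(ltW eA0)//; last lra.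
  rewrite subr0 [ltLHS](_ : _ = (A - 1) * (e / A)); last by rewrite /A; ring.
  by rewrite mulrBl mul1r mulrC divfK ?gt_eqF// ltrBlDr ltrDl.
have : cvg F.
  apply: cauchy_cvg; apply: cauchy_exP => e e0.
  have [d d0 dP] := close e e0.
  have [s Ps ms] := fine_partition b0 d0.
  exists (riemann_sum Xi 0 s); exists d => // _ [s' [Ps' ms' ->]].
  by rewrite -ball_normE /ball_ /=; exact: dP.
move=> /cvg_ex[/= I FI]; exists I => e e0.
have e20 : 0 < e / 2 by lra.
have [d d0 dP] := close _ e20; exists d => // s Ps ms.
have : F (ball I (e / 2)) by apply: FI; exact: nbhsx_ballx.
move=> [d' d'0 /(_ _)sub].
pose d'' := Num.min d d'.
have d''0 : 0 < d'' by rewrite lt_min d0.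
have [s' Ps' ms'] := fine_partition b0 d''0.
have : ball I (e / 2) (riemann_sum Xi 0 s').
  apply: sub; exists s'; split => //; apply: mesh_ltW ms'.
  by rewrite ge_min lexx orbT.
rewrite -ball_normE /ball_ /= distrC => H1.
have ms2 : mesh_lt d 0 s' by apply: mesh_ltW ms'; rewrite ge_min lexx.
have H2 := dP s s' Ps Ps' ms ms2.
have := ler_distD (riemann_sum Xi 0 s') (riemann_sum Xi 0 s) I.
rewrite -/(riemann_sum Xi 0 s); lra.
Qed.

(** * Uniformity from compactness of the time interval *)

(** Compactness of [0, T] in the only form needed below: it turns local
estimates into estimates with a uniform constant C and a uniform scale d. The
near-covering property is applied with parameters (C, d) tending to
(+oo, 0+). *)
Lemma diagonal_uniform (R : realType) (T : R) (Q : R -> R -> R -> Prop) :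
  (forall C C' u v, C <= C' -> Q C u v -> Q C' u v) ->
  (forall x : R, 0 <= x <= T -> exists C, exists2 d : R, 0 < d &
     forall u v : R, 0 <= u <= T -> 0 <= v <= T -> `|u - x| < d -> `|v - x| < d ->
       Q C u v) ->
  exists C, exists2 d : R, 0 < d &
    forall u v : R, 0 <= u <= T -> 0 <= v <= T -> `|u - v| < d -> Q C u v.
Proof.
move=> Qmono Qloc.
have /compact_near_coveringP cov := @segment_compact R 0 T.
pose P (p : R * R) (u : R) := 0 <= u <= T ->
  forall v : R, 0 <= v <= T -> `|u - v| < p.2 -> Q p.1 u v.
pose F : set_system (R * R) := filter_prod (pinfty_nbhs R) (at_right 0).
have covF : \near F, `[0, T] `<=` P F.
  apply: cov => x; rewrite /= in_itv/= => xT.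
  have [C [d d0 H]] := Qloc x xT.
  have d20 : 0 < d / 2 by lra.
  near=> u p => /= uT v vT uv.
  have ux : `|x - u| < d / 2 by near: u; exact: nbhsx_ballx.
  have pd : p.2 < d / 2.
    near: p; exists (setT, [set c | c < d / 2]) => /=; last by move=> ? [].
    by split; [exact: filterT|exact: nbhs_right_lt].
  have pC : C <= p.1.
    near: p; exists ([set c | C <= c], setT) => /=; last by move=> ? [].
    by split; [exact: nbhs_pinfty_ge (num_real _)|exact: filterT].
  have uxd : `|u - x| < d.
    by rewrite distrC; apply: (lt_trans ux); lra.
  have vxd : `|v - x| < d.
    by have := ler_distD u v x; rewrite (distrC v u) (distrC u x); lra.
  exact: Qmono pC (H u v uT vT uxd vxd).
have F0 : \forall p \near F, 0 < p.2.
  exists (setT, [set c | 0 < c]) => /=; last by move=> ? [].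
  by split; [exact: filterT|exact: nbhs_right_gt].
have [[C d] [/= PCd d0]] := @filter_ex _ F _ _ (filterI covF F0).
by exists C, d => // u v uT vT uv; apply: (PCd u).
Unshelve. all: by end_near.
Qed.

(** * Matrix norms and linear maps *)

Section MatrixNorm.
Context {R : realType}.

Lemma mx_norm_coord (m n : nat) (A : 'M[R]_(m, n)) i j : `|A i j| <= `|A|.
Proof.
rewrite /Num.norm /= mx_normrE.
exact: (le_bigmax _ (fun ij => `|A ij.1 ij.2|) (i, j)).
Qed.

Lemma mx_norm_le (m n : nat) (A : 'M[R]_(m, n)) e :
  0 <= e -> (forall i j, `|A i j| <= e) -> `|A| <= e.
Proof.
move=> e0 Ae; rewrite /Num.norm /= mx_normrE.
by apply: bigmax_le => // -[i j] _; exact: Ae.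
Qed.

Lemma mulmx_norm (m n p : nat) (A : 'M[R]_(m, n)) (B : 'M[R]_(n, p)) :
  `|A *m B| <= n%:R * `|A| * `|B|.
Proof.
apply: mx_norm_le => [|i j]; first by rewrite !mulr_ge0.
rewrite mxE; apply: le_trans (ler_norm_sum _ _ _) _.
apply: (@le_trans _ _ (\sum_(k < n) `|A| * `|B|)).
  by apply: ler_sum => k _; rewrite normrM ler_pM// mx_norm_coord.
by rewrite sumr_const card_ord -mulrA mulr_natl.
Qed.

Lemma delta_norm (n : nat) (j : 'I_n) : `|delta_mx j 0 : 'cV[R]_n| <= 1.
Proof.
apply: mx_norm_le => [|i k]; first exact: ler01.
by rewrite mxE normr_nat lern1; case: (_ && _).
Qed.

Lemma cV_delta (n : nat) (v : 'cV[R]_n) : v = \sum_j v j 0 *: delta_mx j 0.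
Proof.
apply/colP => i; rewrite summxE (bigD1 i)//= big1 ?addr0 => [|j ji].
  by rewrite !mxE !eqxx mulr1.
by rewrite !mxE eq_sym (negbTE ji) mulr0.
Qed.

Lemma linear_delta (n : nat) (V : lmodType R) (f : 'cV[R]_n -> V) v :
  linear f -> f v = \sum_j v j 0 *: f (delta_mx j 0).
Proof.
move=> lf; pose F := GRing.isLinear.Build _ _ _ _ f lf.
pose g : {linear _ -> _} := HB.pack f F.
by rewrite -[f]/(g : _ -> _) {1}[v]cV_delta linear_sum; under eq_bigr do rewrite linearZ.
Qed.

Lemma linear_norm (n : nat) (V : normedModType R) (f : 'cV[R]_n -> V) v B :
  linear f -> (forall j, `|f (delta_mx j 0)| <= B) -> `|f v| <= n%:R * B * `|v|.
Proof.
move=> lf fB; rewrite (linear_delta v lf).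
apply: le_trans (ler_norm_sum _ _ _) _.
apply: (@le_trans _ _ (\sum_(j < n) B * `|v|)).
  apply: ler_sum => j _; rewrite normrZ mulrC; apply: ler_pM => //.
  exact: mx_norm_coord.
by rewrite sumr_const card_ord -mulrA mulr_natl.
Qed.

End MatrixNorm.

(** * Bounds extracted from finite Hoelder norms *)

Section Holder.
Context {R : realType}.

Lemma holder_le (V : Type) (T a : R) (N : V -> \bar R) (Z : R -> R -> V) (K : R) :
  (holder T a N Z <= K%:E)%E -> forall s t : R, 0 <= s -> s < t -> t <= T ->
    (N (Z s t) <= (K * (t - s) `^ a)%:E)%E.
Proof.
move=> ZK s t s0 st tT.
have p0 : 0 < (t - s) `^ a by rewrite powR_gt0// subr_gt0.
have : (N (Z s t) * (((t - s) `^ a)^-1)%:E <= K%:E)%E.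
  apply: le_trans ZK; apply: ereal_sup_ubound.
  by exists (s, t).
case: (N (Z s t)) => [x| |] /=.
- by rewrite -EFinM !lee_fin ler_pdivrMr.
- by rewrite gt0_mulye ?lte_fin ?invr_gt0// leye_eq.
- by rewrite leNye.
Qed.

Lemma holder_bound (V : Type) (T a : R) (N : V -> \bar R) (Z : R -> R -> V) :
  (holder T a N Z < +oo)%E -> exists2 K : R, 0 <= K &
    forall s t : R, 0 <= s -> s < t -> t <= T ->
    (N (Z s t) <= (K * (t - s) `^ a)%:E)%E.
Proof.
move=> Zoo; exists `|fine (holder T a N Z)|; first exact: normr_ge0.
apply: holder_le; move: Zoo.
by case: holder => [x| |] //= _; rewrite ?lee_fin ?ler_norm ?leNye.
Qed.

Lemma holder_ge0 (V : Type) (T a : R) (N : V -> \bar R) (Z : R -> R -> V) :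
  0 < T -> (forall v, 0 <= N v)%E -> (0 <= holder T a N Z)%E.
Proof.
move=> T0 N0.
apply: (@le_trans _ _ (N (Z 0%R T) * (((T - 0) `^ a)^-1)%R%:E)%E).
  by rewrite mule_ge0// lee_fin invr_ge0 powR_ge0.
by apply: ereal_sup_ubound; exists (0, T).
Qed.

Lemma opnorm_ge0 (U : normedModType R) (V : Type) (N : V -> \bar R) (f : U -> V) :
  (forall v, 0 <= N v)%E -> (0 <= opnorm N f)%E.
Proof.
move=> N0; apply: le_trans (N0 (f 0)) _; apply: ereal_sup_ubound.
by exists 0 => //=; rewrite normr0.
Qed.

Lemma enorm_ge0 (V : normedModType R) (v : V) : (0 <= enorm v)%E.
Proof. by rewrite lee_fin. Qed.

Lemma opnorm_le (U : normedModType R) (V : Type) (N : V -> \bar R) (f : U -> V)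
    (K : R) u :
  (opnorm N f <= K%:E)%E -> `|u| <= 1 -> (N (f u) <= K%:E)%E.
Proof.
by move=> fK u1; apply: le_trans fK; apply: ereal_sup_ubound; exists u.
Qed.

(** The Gubinelli derivative is only tested on basis vectors: by linearity this
determines it, and contractions with WW see nothing else. *)
Definition controlled_by (M : nat) (V : normedModType R) (T alpha : R)
    (W : R -> 'cV[R]_M) (Y : R -> V) (Y' : R -> 'cV[R]_M -> V) (K : R) : Prop :=
  forall s t : R, 0 <= s -> s < t -> t <= T ->
    (forall j, `|Y' t (delta_mx j 0) - Y' s (delta_mx j 0)| <= K * (t - s) `^ alpha)
    /\ `|Y t - Y s - Y' s (W t - W s)| <= K * (t - s) `^ (2 * alpha).

Lemma controlled_byP (M : nat) (V : normedModType R) (T alpha : R)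
    (W : R -> 'cV[R]_M) (Y : R -> V) (Y' : R -> 'cV[R]_M -> V) :
  controlled T alpha enorm W Y Y' ->
  exists2 K : R, 0 <= K & controlled_by T alpha W Y Y' K.
Proof.
move=> [_ _ /holder_bound[K1 K10 H1] /holder_bound[K2 K20 H2]].
exists (K1 + K2); first by rewrite addr_ge0.
move=> s t s0 st tT; split=> [j|].
  have := opnorm_le (H1 s t s0 st tT) (delta_norm j); rewrite lee_fin.
  by move/le_trans; apply; rewrite ler_wpM2r ?powR_ge0// lerDl.
have := H2 s t s0 st tT; rewrite lee_fin.
by move/le_trans; apply; rewrite ler_wpM2r ?powR_ge0// lerDr.
Qed.

(** Continuity of x |-> (Y(., x), Y'(., x)) in the seminorm makes the constant
locally uniform in x, since the estimates are subadditive. *)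
Lemma controlled_locally_bounded (M : nat) (V X : normedModType R) (T alpha : R)
    (W : R -> 'cV[R]_M) (Y : R -> X -> V) (Y' : R -> X -> 'cV[R]_M -> V) :
  0 < T -> (forall x, controlled T alpha enorm W (Y^~ x) (Y'^~ x)) ->
  continuous_controlled T alpha enorm W Y Y' ->
  forall x0 : X, exists2 K : R, 0 <= K &
    \forall x \near x0, controlled_by T alpha W (Y^~ x) (Y'^~ x) K.
Proof.
move=> T0 ctrl cont x0.
have [K0 K00 HK0] := controlled_byP (ctrl x0).
exists (K0 + 1); first by rewrite addr_ge0.
have : \forall x \near x0, (controlled_seminorm T alpha enorm W
    (fun t => Y t x - Y t x0)%R (fun t => Y' t x - Y' t x0)%R < 1)%E.
  apply: (cont x0 [set y | (y < 1)%E]).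
  apply: filterS (nbhsx_ballx (0 : R) _ ltr01) => r /=.
  rewrite -ball_normE /ball_ /= sub0r normrN lte_fin.
  exact: le_lt_trans (ler_norm _).
apply: filterS => x; rewrite /controlled_seminorm => lt1.
set h1 := holder _ _ _ _ in lt1; set h2 := holder _ _ _ _ in lt1.
have h10 : (0 <= h1)%E by apply: holder_ge0 => // f; apply: opnorm_ge0 => v; exact: enorm_ge0.
have h20 : (0 <= h2)%E by apply: holder_ge0 => // f; exact: enorm_ge0.
have h11 : (h1 <= 1%:E)%E by apply: le_trans (ltW lt1); rewrite leeDl.
have h21 : (h2 <= 1%:E)%E by apply: le_trans (ltW lt1); rewrite leeDr.
move=> s t s0 st tT; have [A1 A2] := HK0 s t s0 st tT; split=> [j|].
  have := opnorm_le (holder_le h11 s0 st tT) (delta_norm j); rewrite lee_fin mul1r.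
  rewrite /incr /= => B1; have {}A1 := A1 j.
  have -> : Y' t x (delta_mx j 0) - Y' s x (delta_mx j 0) =
    (Y' t x0 (delta_mx j 0) - Y' s x0 (delta_mx j 0)) +
    ((Y' t x - Y' t x0) - (Y' s x - Y' s x0)) (delta_mx j 0).
    rewrite [((_ - _) - (_ - _)) _](_ : _ = Y' t x (delta_mx j 0) -
      Y' t x0 (delta_mx j 0) -
      (Y' s x (delta_mx j 0) - Y' s x0 (delta_mx j 0)))//.
    by rewrite opprB !addrA [RHS](ACl (3*6*(1*4)*(2*5)))/= subrr addNr !addr0.
  by apply: le_trans (ler_normD _ _) _; rewrite mulrDl mul1r lerD.
have := holder_le h21 s0 st tT; rewrite lee_fin mul1r /remainder /incr => B1.
have -> : Y t x - Y s x - Y' s x (W t - W s) =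
   (Y t x0 - Y s x0 - Y' s x0 (W t - W s)) +
   (Y t x - Y t x0 - (Y s x - Y s x0) - (Y' s x - Y' s x0) (W t - W s)).
  rewrite [(Y' s x - Y' s x0) _](_ : _ = Y' s x (W t - W s) -
    Y' s x0 (W t - W s))// !opprB !addrA.
  by rewrite [RHS](ACl (4*7*9*(1*5)*(2*6)*(3*8)))/= subrr !addNr !addr0.
by apply: le_trans (ler_normD _ _) _; rewrite mulrDl mul1r lerD.
Qed.

End Holder.

(** * Taylor expansion and symmetry of the second derivative *)

Section ScalarMeanValue.
Context {R : realType}.

Lemma mvt (g dg : R -> R) (a b : R) : (forall t : R, is_derive t 1 g (dg t)) ->
  a < b -> exists2 c : R, a < c < b & g b - g a = dg c * (b - a).
Proof.
move=> gdg ab; have gc : {within `[a, b], continuous g}.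
  by apply: derivable_within_continuous => t _; have [] := gdg t.
have [c cab E] := @MVT _ g dg a b ab (fun t _ => gdg t) gc.
by exists c => //; rewrite in_itv in cab.
Qed.

Lemma mean_value_le (g dg : R -> R) (C : R) :
  (forall t : R, is_derive t 1 g (dg t)) ->
  (forall t : R, 0 <= t <= 1 -> `|dg t| <= C) ->
  forall t : R, 0 <= t <= 1 -> `|g t - g 0| <= C.
Proof.
move=> gdg dgC t /andP[]; rewrite le_eqVlt => /predU1P[<- _|t0 t1].
  rewrite subrr normr0; apply: le_trans (normr_ge0 (dg 0)) (dgC _ _).
  by rewrite lexx ler01.
have [c /andP[c0 ct] ->] := mvt gdg t0.
rewrite subr0 normrM (gtr0_norm t0) -[leRHS]mulr1.
by apply: ler_pM => //; [exact: ltW|apply: dgC; lra].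
Qed.

(** Three applications of the mean value inequality, each to a function minus
its Taylor polynomial. *)
Lemma scalar_taylor3 (g g1 g2 g3 : R -> R) (C : R) :
  (forall t : R, is_derive t 1 g (g1 t)) ->
  (forall t : R, is_derive t 1 g1 (g2 t)) ->
  (forall t : R, is_derive t 1 g2 (g3 t)) ->
  (forall t : R, 0 <= t <= 1 -> `|g3 t| <= C) ->
  `|g 1 - g 0 - g1 0 - 2^-1 * g2 0| <= C.
Proof.
move=> D1 D2 D3 H3.
have H2 := mean_value_le D3 H3.
pose p1 (t : R) := g1 t - t * g2 0.
have Dp1 (t : R) : is_derive t 1 p1 (g2 t - g2 0).
  rewrite /p1; apply: is_derive_eq.
  by rewrite /GRing.scale /=; ring.
have H1 := mean_value_le Dp1 H2.
pose p0 (t : R) := g t - t * g1 0 - t ^+ 2 * (2^-1 * g2 0).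
have Dp0 (t : R) : is_derive t 1 p0 (p1 t - p1 0).
  rewrite /p0; apply: is_derive_eq.
  by rewrite /p1 /GRing.scale /=; field.
have /(_ 1) := mean_value_le Dp0 H1.
rewrite ler01 lexx /p0 => /(_ isT); congr (`|_| <= _); ring.
Qed.

End ScalarMeanValue.

Section Lines.
Context {R : realType} {V : normedModType R} {n : nat}.
Implicit Types (f : V -> 'cV[R]_n).

Lemma is_derive_line f (x h : V) i (t : R) :
  differentiable f (x + t *: h) ->
  is_derive t 1 (fun r => f (x + r *: h) i 0) ('d f (x + t *: h) h i 0).
Proof.
move=> df.
have lim : (fun r : R => r^-1 *: (f (x + (r *: 1 + t) *: h) i 0 - f (x + t *: h) i 0))
    @ 0^' --> 'd f (x + t *: h) h i 0.
  rewrite -deriveE//.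
  have dv : derivable f (x + t *: h) h by exact: diff_derivable.
  have lim : (fun r : R => r^-1 *: (f (r *: h + (x + t *: h)) - f (x + t *: h))) @ 0^' -->
    'D_h f (x + t *: h) by exact: dv.
  apply: cvg_trans (continuous_cvg _ (@coord_continuous _ _ _ i 0 _) lim); apply: near_eq_cvg; near=> r => /=.
  rewrite !mxE scalerDl addrCA.
  by rewrite [r *: 1]mulr1.
split; first by apply/cvg_ex; exists ('d f (x + t *: h) h i 0).
exact: cvg_lim.
Unshelve. all: by end_near.
Qed.

Lemma iterdiff_linear (W : normedModType R) (f : V -> W) (vs1 vs2 : seq V) x :
  smooth f -> linear (fun v => iterdiff f (vs1 ++ v :: vs2) x).
Proof.
move=> sf a v w; elim: vs1 x => [|u vs1 IH] x /=; first by rewrite linearP.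
have -> : iterdiff f (vs1 ++ (a *: v + w) :: vs2) =
   a *: iterdiff f (vs1 ++ v :: vs2) + iterdiff f (vs1 ++ w :: vs2).
  by apply/funext => y; exact: IH.
have d1 : differentiable (iterdiff f (vs1 ++ v :: vs2)) x by exact: sf.
have d2 : differentiable (iterdiff f (vs1 ++ w :: vs2)) x by exact: sf.
by rewrite diffD// ?diffZ//; exact: differentiableZ.
Qed.

(** The mean value theorem along a, then along b. *)
Lemma second_difference f (x a b : V) (s : R) i : smooth f -> 0 < s ->
  exists r t : R, [/\ 0 < r < s, 0 < t < s &
    f (x + s *: b + s *: a) i 0 - f (x + s *: a) i 0
      - (f (x + s *: b) i 0 - f x i 0) =
    s * s * iterdiff f [:: b; a] (x + r *: a + t *: b) i 0].
Proof.
move=> sf s0.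
have D0 y := sf [::] y; have D1 y := sf [:: a] y.
pose g (r : R) := f (x + s *: b + r *: a) i 0 - f (x + r *: a) i 0.
pose dg (r : R) := 'd f (x + s *: b + r *: a) a i 0 - 'd f (x + r *: a) a i 0.
have gdg (r : R) : is_derive r 1 g (dg r).
  by apply: is_deriveB; apply: is_derive_line; exact: D0.
have [r r0s gE] := mvt gdg s0.
pose k (t : R) := 'd f (x + r *: a + t *: b) a i 0.
have kdk (t : R) : is_derive t 1 k (iterdiff f [:: b; a] (x + r *: a + t *: b) i 0).
  exact: (@is_derive_line (iterdiff f [:: a]) _ _ i t (D1 _)).
have [t t0s kE] := mvt kdk s0.
exists r, t; split => //.
move: gE kE; rewrite /g /dg /k !scale0r !addr0 !subr0 => -> .
rewrite (addrAC x (s *: b)) => ->.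
ring.
Qed.

(** Both mixed derivatives are limits of the same second difference quotient,
by [second_difference] with the roles of a and b exchanged. *)
Lemma second_derivative_symmetric f (x a b : V) : smooth f ->
  iterdiff f [:: a; b] x = iterdiff f [:: b; a] x.
Proof.
move=> sf; apply/colP => i.
have coef_cont (v w : V) (e : R) : 0 < e -> exists2 d : R, 0 < d &
    forall y, `|y - x| < d -> `|iterdiff f [:: v; w] y i 0 - iterdiff f [:: v; w] x i 0| < e.
  move=> e0.
  have : (fun y => iterdiff f [:: v; w] y i 0) @ x --> iterdiff f [:: v; w] x i 0.
    apply: (continuous_cvg _ (@coord_continuous _ _ _ i 0 _)).
    exact: (differentiable_continuous (sf [:: v; w] x)).
  move=> /cvgrPdist_lt /(_ e e0) /nbhs_ballP [d d0 H]; exists d => // y yd.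
  by rewrite distrC; apply: H; rewrite -ball_normE /ball_ /= distrC.
apply/eqP; rewrite -subr_eq0 -normr_le0; apply/ler_addgt0Pr => e e0; rewrite add0r.
have e20 : 0 < e / 2 by lra.
have [d1 d10 H1] := coef_cont a b _ e20; have [d2 d20 H2] := coef_cont b a _ e20.
pose d := Num.min d1 d2.
have d0 : 0 < d by rewrite lt_min d10.
pose s := d / (`|a| + `|b| + 1).
have ab0 : 0 < `|a| + `|b| + 1 by rewrite ltr_wpDl// addr_ge0.
have s0 : 0 < s by rewrite divr_gt0.
have small v w (r t : R) : 0 < r < s -> 0 < t < s -> `|v| + `|w| = `|a| + `|b| ->
    `|x + r *: v + t *: w - x| < d.
  move=> /andP[r0 rs] /andP[t0 ts] vw; rewrite addrAC (addrAC x) subrr add0r.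
  apply: le_lt_trans (ler_normD _ _) _.
  rewrite !normrZ !gtr0_norm//.
  apply: (@le_lt_trans _ _ (s * (`|a| + `|b|))).
    by rewrite -vw mulrDr lerD// ler_wpM2r// ltW.
  by rewrite /s mulrAC ltr_pdivrMr// ltr_pM2l// ltrDl.
have [r [t [rs ts E1]]] := second_difference x a b i sf s0.
have [r' [t' [rs' ts' E2]]] := second_difference x b a i sf s0.
have dd1 : d <= d1 by rewrite ge_min lexx.
have dd2 : d <= d2 by rewrite ge_min lexx orbT.
have A2 := H2 _ (lt_le_trans (small a b r t rs ts erefl) dd2).
have A1 := H1 _ (lt_le_trans (small b a r' t' rs' ts' (addrC _ _)) dd1).
have E : iterdiff f [:: b; a] (x + r *: a + t *: b) i 0 =
         iterdiff f [:: a; b] (x + r' *: b + t' *: a) i 0.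
  have ss0 : s * s != 0 by rewrite mulf_neq0// gt_eqF.
  apply: (mulfI ss0); rewrite -E1 -E2 (addrAC x (s *: a)); ring.
rewrite -E in A1.
set z := iterdiff f [:: b; a] (x + _ + _) i 0 in A1 A2.
have := ler_distD z (iterdiff f [:: a; b] x i 0) (iterdiff f [:: b; a] x i 0).
rewrite (distrC _ z); lra.
Qed.

Lemma taylor3 f (x h : V) (C : R) : smooth f ->
  (forall t : R, 0 <= t <= 1 -> `|iterdiff f [:: h; h; h] (x + t *: h)| <= C) ->
  `|f (x + h) - f x - 'd f x h - 2^-1 *: iterdiff f [:: h; h] x| <= C.
Proof.
move=> sf HC.
have C0 : 0 <= C by apply: le_trans (normr_ge0 _) (HC 0 _); rewrite lexx ler01.
apply: mx_norm_le => // i j; rewrite (ord1 j).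
have D (k : nat) (t : R) := @is_derive_line (iterdiff f (nseq k h)) x h i t (sf _ _).
have := @scalar_taylor3 R _ _ _ _ C (D 0) (D 1) (D 2).
rewrite !mxE /= !scale1r !scale0r !addr0; apply => t t01.
by apply: le_trans (mx_norm_coord _ _ _) (HC t t01).
Qed.

End Lines.

(** * Fields evaluated along a continuous path *)

Section Paths.
Context {R : realType} {V W : normedModType R}.
Implicit Types (T : R) (Y : R -> V) (g : R -> V -> W).

Lemma within_itvP T (F : normedModType R) (f : R -> F) :
  {within `[0, T], continuous f} <->
  (forall x : R, 0 <= x <= T -> forall e : R, 0 < e -> exists2 d : R, 0 < d &
     forall u : R, 0 <= u <= T -> `|u - x| < d -> `|f u - f x| < e).
Proof.
rewrite subspace_continuousP; split=> H x xT.
  move=> e e0; have : `[0, T]%classic x by rewrite /= in_itv.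
  move=> /H /cvgrPdist_lt /(_ e e0); rewrite near_withinE.
  move=> /nbhs_ballP[d d0 dP]; exists d => // u uT ux.
  rewrite distrC; apply: dP; last by rewrite /= in_itv.
  by rewrite -ball_normE /ball_ /= distrC.
rewrite /= in_itv/= in xT.
apply/cvgrPdist_lt => e e0; have [d d0 dP] := H x xT e e0.
rewrite near_withinE; apply/nbhs_ballP; exists d => // u.
rewrite -ball_normE /ball_ /= in_itv/= distrC => ux uT.
by rewrite distrC; exact: dP.
Qed.

Lemma jointly_continuousP T g :
  jointly_continuous T g <->
  (forall (x : R) (y : V), 0 <= x <= T -> forall e : R, 0 < e -> exists2 d : R, 0 < d &
     forall (u : R) z, 0 <= u <= T -> `|u - x| < d -> `|z - y| < d ->
       `|g u z - g x y| < e).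
Proof.
rewrite /jointly_continuous subspace_continuousP; split=> H.
  move=> x y xT e e0.
  have /H /cvgrPdist_lt /(_ e e0) : [set p : R * V | 0 <= p.1 <= T] (x, y) by [].
  rewrite near_withinE => /nbhs_ballP[d d0 dP]; exists d => // u z uT ux zy.
  rewrite distrC; apply: (dP (u, z)) => //=.
  by split; rewrite -ball_normE /ball_ /= distrC.
move=> [x y] /= xT; apply/cvgrPdist_lt => e e0; have [d d0 dP] := H x y xT e e0.
rewrite near_withinE; apply/nbhs_ballP; exists d => // -[u z] [].
rewrite -!ball_normE /ball_ /= => ux zy uT.
by rewrite distrC; apply: dP => //; rewrite distrC.
Qed.

Lemma joint_path_continuous T g Y :
  jointly_continuous T g -> {within `[0, T], continuous Y} ->
  {within `[0, T], continuous (fun s => g s (Y s))}.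
Proof.
move=> /jointly_continuousP gc /within_itvP Yc; apply/within_itvP => x xT e e0.
have [d d0 dP] := gc x (Y x) xT e e0; have [d' d'0 d'P] := Yc x xT d d0.
exists (Num.min d d'); first by rewrite lt_min d0.
move=> u uT; rewrite lt_min => /andP[ud ud'].
by apply: dP => //; exact: d'P.
Qed.

Lemma holder_path_continuous T (a K : R) Y : 0 < a ->
  (forall s t : R, 0 <= s -> s < t -> t <= T -> `|Y t - Y s| <= K * (t - s) `^ a) ->
  {within `[0, T], continuous Y}.
Proof.
move=> a0 HY; apply/within_itvP => x xT e e0.
pose B := `|K| + 1.
have B0 : 0 < B by rewrite /B ltr_wpDl.
have eB0 : 0 < e / B by rewrite divr_gt0.
exists ((e / B) `^ a^-1); first exact: powR_gt0.
move=> u uT ux.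
have key (r : R) : 0 < r -> r < (e / B) `^ a^-1 -> K * r `^ a < e.
  move=> r0 rd.
  have : r `^ a <= e / B.
    rewrite -[leRHS]powRr1 ?(ltW eB0)// -(mulVf (negbT (gt_eqF a0))) powRrM.
    by apply: ge0_ler_powR; rewrite ?nnegrE ?powR_ge0//; lra.
  rewrite ler_pdivlMr// => rB.
  have ra0 : 0 < r `^ a by rewrite powR_gt0.
  have := ler_norm K; rewrite /B in rB; nra.
have [xu|xu|->] := ltgtP x u; last by rewrite subrr normr0.
  apply: le_lt_trans (HY x u _ xu _) _; [lra|lra|].
  by apply: key; move: ux; rewrite gtr0_norm; lra.
rewrite distrC; apply: le_lt_trans (HY u x _ xu _) _; [lra|lra|].
by apply: key; move: ux; rewrite ltr0_norm; lra.
Qed.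

(** Two independent times s and r are allowed in order to treat both the drift
at a frozen point, g(s, Y_v), and the drift along the path, g(s, Y_s). *)
Lemma joint_uniform T g Y (e : R) :
  jointly_continuous T g -> {within `[0, T], continuous Y} -> 0 < e ->
  exists2 d : R, 0 < d & forall u v : R, 0 <= u -> u <= v -> v <= T -> v - u < d ->
    forall s r : R, u <= s <= v -> u <= r <= v -> `|g s (Y r) - g u (Y u)| <= e.
Proof.
move=> /jointly_continuousP gc /within_itvP Yc e0.
pose Q (C u v : R) := forall s r : R, u <= s <= v -> u <= r <= v ->
  `|g s (Y r) - g u (Y u)| <= e.
have e20 : 0 < e / 2 by lra.
have [//|x xT|C [d d0 H]] := @diagonal_uniform R T Q.
  have [d d0 dP] := gc x (Y x) xT _ e20; have [d' d'0 d'P] := Yc x xT d d0.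
  exists 0, (Num.min d d'); first by rewrite lt_min d0.
  move=> u v uT vT; rewrite !lt_min => /andP[ud ud'] /andP[vd vd'] s r us ur.
  have mid t (dd : R) : u <= t <= v -> `|u - x| < dd -> `|v - x| < dd -> `|t - x| < dd.
    by rewrite !ltr_norml; lra.
  have sT : 0 <= s <= T by lra.
  have rT : 0 <= r <= T by lra.
  have := dP s (Y r) sT (mid _ _ us ud vd) (d'P r rT (mid _ _ ur ud' vd')).
  have := dP u (Y u) uT ud (d'P u uT ud').
  have := ler_distD (g x (Y x)) (g s (Y r)) (g u (Y u)).
  by rewrite (distrC (g x (Y x))); lra.
exists d => // u v u0 uv vT vud; apply: H; [lra|lra|].
by rewrite distrC ger0_norm; lra.
Qed.

(** Taylor remainders live on the segment from Y_u to Y_v; for u and v close to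
x it lies in a small ball around Y_x, by convexity. *)
Lemma joint_bounded T g Y :
  jointly_continuous T g -> {within `[0, T], continuous Y} ->
  exists2 C : R, 0 <= C & exists2 d : R, 0 < d &
    forall u v : R, 0 <= u <= T -> 0 <= v <= T -> `|u - v| < d ->
    forall r : R, 0 <= r <= 1 -> `|g u (Y u + r *: (Y v - Y u))| <= C.
Proof.
move=> /jointly_continuousP gc /within_itvP Yc.
pose Q (C u v : R) := forall r : R, 0 <= r <= 1 ->
  `|g u (Y u + r *: (Y v - Y u))| <= C.
have [||C [d d0 H]] := @diagonal_uniform R T Q.
- by move=> C C' u v CC' H r r01; exact: le_trans (H r r01) CC'.
- move=> x xT.
  have [d d0 dP] := gc x (Y x) xT _ ltr01; have [d' d'0 d'P] := Yc x xT d d0.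
  exists (`|g x (Y x)| + 1), (Num.min d d'); first by rewrite lt_min d0.
  move=> u v uT vT; rewrite !lt_min => /andP[ud ud'] /andP[vd vd'] r r01.
  set z := Y u + _.
  have zx : `|z - Y x| < d.
    have -> : z - Y x = (1 - r) *: (Y u - Y x) + r *: (Y v - Y x).
      rewrite /z !scalerBr !scalerBl !scale1r !opprB !addrA.
      by rewrite [RHS](ACl (1*5*2*4*(3*6)))/= subrr addr0.
    have := d'P u uT ud'; have := d'P v vT vd'.
    set A := `|Y v - Y x|; set B := `|Y u - Y x| => AD BD.
    apply: le_lt_trans (ler_normD _ _) _; rewrite !normrZ -/A -/B.
    rewrite !ger0_norm; [|lra|lra].
    have [r1|r1] := eqVneq r 1; first by rewrite r1; lra.
    have : 0 < 1 - r by rewrite subr_gt0 lt_neqAle r1; lra.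
    by move: r01 => /andP[]; nra.
  have := dP u z uT ud zx.
  by have := ler_normD (g u z - g x (Y x)) (g x (Y x)); rewrite subrK; lra.
exists `|C|; first exact: normr_ge0.
by exists d => // u v uT vT uv r r01; apply: le_trans (H u v uT vT uv r r01) (ler_norm _).
Qed.

End Paths.

(** * Time integrals *)

Section TimeIntegral.
Context {R : realType} {D : nat}.
Implicit Types (f : R -> 'cV[R]_D).

Lemma coord_integrable f (u v : R) i : {within `[u, v], continuous f} ->
  lebesgue_measure.-integrable `[u, v] (EFin \o (fun s => f s i 0)).
Proof.
move=> fc; apply: continuous_compact_integrable; first exact: segment_compact.
by move=> x; apply: (continuous_cvg _ (@coord_continuous _ _ _ i 0 _)); exact: fc.
Qed.

Lemma time_integralB f (u v : R) : {within `[0, v], continuous f} ->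
  0 <= u -> u <= v ->
  time_integral 0 v f - time_integral 0 u f = time_integral u v f.
Proof.
move=> fc u0 uv; apply/colP => i; rewrite !mxE.
have fi := coord_integrable i fc.
rewrite (Rintegral_itvB fi) ?bnd_simp//.
apply: Rintegral_itv_obnd_cbnd; apply: integrableS fi => //.
by apply: subset_itv; rewrite bnd_simp.
Qed.

Lemma time_integral_close f (u v e : R) (c : 'cV[R]_D) :
  {within `[u, v], continuous f} -> u <= v -> 0 <= e ->
  (forall s : R, u <= s <= v -> `|f s - c| <= e) ->
  `|time_integral u v f - (v - u) *: c| <= e * (v - u).
Proof.
move=> fc uv e0 fe; apply: mx_norm_le => [|i j]; first by rewrite mulr_ge0// subr_ge0.
rewrite (ord1 j) !mxE.
have fi := coord_integrable i fc.
have mE (r : R) : \int[lebesgue_measure]_(s in `[u, v]) r = r * (v - u) :> R.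
  rewrite Rintegral_cst//; congr (_ * _).
  have := lebesgue_measure_itv `[u, v]%R; rewrite /= lte_fin => ->.
  case: ltP => //= vu.
  by rewrite (@le_anti _ _ u v) ?uv ?subrr.
have ci (r : R) : lebesgue_measure.-integrable `[u, v] (EFin \o (fun _ : R => r)).
  apply: continuous_compact_integrable; first exact: segment_compact.
  exact: cst_continuous.
have fie (s : R) : `[u, v]%classic s -> `|f s i 0 - c i 0| <= e.
  rewrite /= in_itv/= => /fe; apply: le_trans.
  by have := mx_norm_coord (f s - c) i 0; rewrite !mxE.
have up : \int[lebesgue_measure]_(s in `[u, v]) f s i 0 <= (c i 0 + e) * (v - u) :> R.
  rewrite -mE; apply: le_Rintegral => // s /fie; rewrite ler_norml; lra.
have lo : (c i 0 - e) * (v - u) <= \int[lebesgue_measure]_(s in `[u, v]) f s i 0 :> R.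
  rewrite -mE; apply: le_Rintegral => // s /fie; rewrite ler_norml; lra.
rewrite ler_norml -(mulrC (c i 0)).
rewrite lerBrDr lerBlDr -mulNr -!mulrDl (addrC (- e)) (addrC e).
by rewrite lo up.
Qed.

End TimeIntegral.

(** * Contraction of tensors with bilinear maps *)

Section Tensors.
Context {R : realType} {M D : nat}.
Implicit Types (b : 'cV[R]_M -> 'cV[R]_M -> 'cV[R]_D) (X : 'M[R]_M).

Lemma eq_tapply b b' X :
  (forall i j, b (delta_mx i 0) (delta_mx j 0) = b' (delta_mx i 0) (delta_mx j 0)) ->
  tapply b X = tapply b' X.
Proof. by move=> bb'; apply: eq_bigr => i _; apply: eq_bigr => j _; rewrite bb'. Qed.

Lemma tapplyDl b b' X :
  tapply (fun v w => b v w + b' v w) X = tapply b X + tapply b' X.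
Proof.
rewrite /tapply -big_split; apply: eq_bigr => i _ /=.
by rewrite -big_split; apply: eq_bigr => j _ /=; rewrite scalerDr.
Qed.

Lemma tapplyBl b b' X :
  tapply (fun v w => b v w - b' v w) X = tapply b X - tapply b' X.
Proof.
rewrite /tapply -sumrB; apply: eq_bigr => i _ /=.
by rewrite -sumrB; apply: eq_bigr => j _ /=; rewrite scalerBr.
Qed.

Lemma tapplyDr b X X' : tapply b (X + X') = tapply b X + tapply b X'.
Proof.
rewrite /tapply -big_split; apply: eq_bigr => i _ /=.
by rewrite -big_split; apply: eq_bigr => j _ /=; rewrite mxE scalerDl.
Qed.

Lemma tapplyNr b X : tapply b (- X) = - tapply b X.
Proof.
rewrite /tapply -sumrN; apply: eq_bigr => i _ /=.
by rewrite -sumrN; apply: eq_bigr => j _ /=; rewrite mxE scaleNr.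
Qed.

Lemma tapply_tr b X : tapply b X^T = tapply (fun v w => b w v) X.
Proof.
rewrite /tapply exchange_big /=; apply: eq_bigr => i _ /=.
by apply: eq_bigr => j _; rewrite mxE.
Qed.

Lemma tapply_tensor b v w : (forall v, linear (b v)) -> (forall w, linear (b^~ w)) ->
  tapply b (tensor v w) = b v w.
Proof.
move=> lr ll; rewrite [RHS](linear_delta v (ll w)); apply: eq_bigr => i _.
rewrite (linear_delta w (lr _)) scaler_sumr; apply: eq_bigr => j _.
by rewrite scalerA /tensor mxE big_ord1 mxE.
Qed.

Lemma tapply_norm b X (B : R) :
  (forall i j, `|b (delta_mx i 0) (delta_mx j 0)| <= B) ->
  `|tapply b X| <= M%:R * (M%:R * (`|X| * B)).
Proof.
move=> bB; apply: le_trans (ler_norm_sum _ _ _) _.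
apply: (@le_trans _ _ (\sum_(i < M) (M%:R * (`|X| * B)))); last first.
  by rewrite sumr_const card_ord [leRHS]mulr_natl.
apply: ler_sum => i _; apply: le_trans (ler_norm_sum _ _ _) _.
apply: (@le_trans _ _ (\sum_(i < M) (`|X| * B))); last first.
  by rewrite sumr_const card_ord [leRHS]mulr_natl.
by apply: ler_sum => j _; rewrite normrZ ler_pM// mx_norm_coord.
Qed.

Lemma tapply_bracket (W : R -> 'cV[R]_M) (WW : R -> R -> 'M[R]_M) b (u v : R) :
  (forall v, linear (b v)) -> (forall w, linear (b^~ w)) ->
  tapply b (bracket W WW u v) = b (incr W u v) (incr W u v)
    - (tapply b (WW u v) + tapply (fun x y => b y x) (WW u v)).
Proof.
move=> lr ll; rewrite /bracket tapplyDr tapply_tensor// tapplyNr.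
by rewrite /sym scalerA divff ?pnatr_eq0// scale1r tapplyDr tapply_tr.
Qed.

End Tensors.

(** * The germs of rough and Young integrals *)

Section Germs.
Context {R : realType} {M D : nat}.
Variables (T alpha : R) (W : R -> 'cV[R]_M) (WW : R -> R -> 'M[R]_M).
Hypotheses (a3 : 3^-1 < alpha) (hW : rough_path T alpha W WW).

Lemma powR_cube (r : R) : 0 < r -> r `^ (2 * alpha) * r `^ alpha = r `^ (3 * alpha).
Proof.
move=> r0; rewrite -powRD; first by congr (_ `^ _); ring.
by apply/implyP => _; rewrite gt_eqF.
Qed.

Lemma powR_square (r : R) : 0 < r -> r `^ alpha * r `^ alpha = r `^ (2 * alpha).
Proof.
move=> r0; rewrite -powRD; first by congr (_ `^ _); ring.
by apply/implyP => _; rewrite gt_eqF.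
Qed.

Lemma alpha_gt0 : 0 < alpha.
Proof. by apply: lt_trans a3; rewrite invr_gt0. Qed.

Lemma three_alpha : 1 < 3 * alpha. Proof. by rewrite -ltr_pdivrMl// mulr1. Qed.

Lemma powR_cube_le (r r1 r2 : R) : 0 <= r1 -> r1 <= r -> 0 <= r2 -> r2 <= r -> 0 < r ->
  r1 `^ (2 * alpha) * r2 `^ alpha <= r `^ (3 * alpha).
Proof.
move=> r10 r1r r20 r2r r0; rewrite -powR_cube//; have a0 := alpha_gt0.
by apply: ler_pM; rewrite ?powR_ge0//; apply: ge0_ler_powR; rewrite ?nnegrE; lra.
Qed.

Definition path_bound (K : R) := forall s t : R, 0 <= s -> s < t -> t <= T ->
  `|incr W s t| <= K * (t - s) `^ alpha /\ `|WW s t| <= K * (t - s) `^ (2 * alpha).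

Lemma rough_path_bound : exists2 K, 0 <= K & path_bound K.
Proof.
case: hW => /holder_bound[K1 K10 H1] /holder_bound[K2 K20 H2] _.
exists (K1 + K2); first by rewrite addr_ge0.
move=> s t s0 st tT; split.
  have := H1 s t s0 st tT; rewrite lee_fin => /le_trans; apply.
  by rewrite ler_wpM2r ?powR_ge0// lerDl.
have := H2 s t s0 st tT; rewrite lee_fin => /le_trans; apply.
by rewrite ler_wpM2r ?powR_ge0// lerDr.
Qed.

Definition rough_germ (Z : R -> 'M[R]_(D, M)) (Z' : R -> 'cV[R]_M -> 'M[R]_(D, M))
  (u v : R) : 'cV[R]_D :=
  Z u *m incr W u v + tapply (fun x y => Z' u x *m y) (WW u v).

Definition rough_const (K KW : R) : R :=
  M%:R * (K * KW) + M%:R * (M%:R * (M%:R * (K * KW))).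

Lemma rough_const_ge0 K KW : 0 <= K -> 0 <= KW -> 0 <= rough_const K KW.
Proof. by move=> K0 KW0; rewrite addr_ge0// !mulr_ge0. Qed.

Lemma incr_split (s u t : R) : incr W s t = incr W s u + incr W u t.
Proof. by rewrite /incr [RHS]addrC addrA subrK. Qed.

Lemma mulmx_bilinear (Z : 'cV[R]_M -> 'M[R]_(D, M)) : linear Z ->
  (forall v, linear (fun w : 'cV[R]_M => Z v *m w)) /\
  (forall w : 'cV[R]_M, linear (fun v => Z v *m w)).
Proof.
move=> lZ; split=> v a x y /=; first by rewrite linearP.
by rewrite lZ mulmxDl scalemxAl.
Qed.

(** By Chen's relation the defect of the germ is
- R_{s,u} W_{u,t} - (Z'_u - Z'_s) WW_{u,t}. *)
Lemma rough_germ_additive Z Z' K KW : 0 <= K -> 0 <= KW -> path_bound KW ->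
  (forall t : R, 0 <= t <= T -> linear (Z' t)) ->
  controlled_by T alpha W Z Z' K ->
  almost_additive T (3 * alpha) (rough_const K KW) (rough_germ Z Z').
Proof.
move=> K0 KW0 bW lZ ctrl s u t s0 su ut tT.
have [_ _ /(_ s u t s0 su ut tT) chen] := hW.
have u0 : 0 <= u by lra.
have uT : u <= T by lra.
have [W1 W2] := bW u t u0 ut tT.
have [Z1 Z2] := ctrl s u s0 su uT.
have lZs : linear (Z' s) by apply: lZ; lra.
have [lr ll] := mulmx_bilinear lZs.
have -> : rough_germ Z Z' s t - rough_germ Z Z' s u - rough_germ Z Z' u t =
   - ((Z u - Z s - Z' s (W u - W s)) *m incr W u t)
   - tapply (fun x y => (Z' u x - Z' s x) *m y) (WW u t).
  rewrite /rough_germ.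
  have -> : WW s t = WW s u + WW u t + tensor (incr W s u) (incr W u t).
    by rewrite chen -[X in _ + X]addrA -opprD [RHS]addrC subrK.
  rewrite !tapplyDr (tapply_tensor _ _ lr ll) (incr_split s u t) mulmxDr.
  have -> : tapply (fun x y => (Z' u x - Z' s x) *m y) (WW u t) =
    tapply (fun x y => Z' u x *m y) (WW u t) - tapply (fun x y => Z' s x *m y) (WW u t).
    by rewrite -tapplyBl; apply: eq_tapply => i j; rewrite mulmxBl.
  rewrite -/(incr W s u) !mulmxBl.
  by apply/colP => i; rewrite !mxE; ring.
apply: le_trans (ler_normB _ _) _; rewrite normrN /rough_const mulrDl.
apply: lerD.
  apply: le_trans (mulmx_norm _ _) _.
  rewrite -!mulrA; apply: ler_wpM2l => //.
  apply: le_trans (ler_pM _ _ Z2 W1) _ => //.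
  rewrite [leLHS](_ : _ = (K * KW) * ((u - s) `^ (2 * alpha) * (t - u) `^ alpha)); last by ring.
  rewrite [leRHS]mulrA; apply: ler_wpM2l; first by rewrite mulr_ge0.
  by apply: powR_cube_le; lra.
apply: le_trans (@tapply_norm _ _ _ _ _ (M%:R * (K * (u - s) `^ alpha)) _) _.
  move=> i j; apply: le_trans (mulmx_norm _ _) _.
  rewrite -[leRHS]mulr1; apply: ler_pM => //; last exact: delta_norm.
  by apply: ler_wpM2l => //; exact: Z1.
rewrite -!(mulrA M%:R); apply: ler_wpM2l => //; apply: ler_wpM2l => //.
have p1 : 0 <= K * (u - s) `^ alpha by rewrite mulr_ge0 ?powR_ge0.
apply: le_trans (ler_wpM2r (mulr_ge0 (ler0n _ M) p1) W2) _.
rewrite [leLHS](_ : _ = M%:R * ((K * KW) * ((t - u) `^ (2 * alpha) * (u - s) `^ alpha))); last by ring.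
apply: ler_wpM2l => //; apply: ler_wpM2l; first by rewrite mulr_ge0.
by apply: powR_cube_le; lra.
Qed.

Definition young_germ (f : R -> 'cV[R]_M -> 'cV[R]_M -> 'cV[R]_D) (u v : R) :
  'cV[R]_D := tapply (f u) (bracket W WW u v).

Definition integrand_bound (f : R -> 'cV[R]_M -> 'cV[R]_M -> 'cV[R]_D) (K : R) :=
  forall s t : R, 0 <= s -> s < t -> t <= T -> forall i j,
    `|f t (delta_mx i 0) (delta_mx j 0) - f s (delta_mx i 0) (delta_mx j 0)|
      <= K * (t - s) `^ alpha.

Lemma young_integrand_bound (f : R -> 'cV[R]_M -> 'cV[R]_M -> 'cV[R]_D) : young_integrand T alpha f ->
  exists2 K, 0 <= K & integrand_bound f K.
Proof.
move=> /holder_bound[K K0 H]; exists K => // s t s0 st tT i j.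
have H1 := opnorm_le (H s t s0 st tT) (delta_norm i).
by have := opnorm_le H1 (delta_norm j); rewrite lee_fin.
Qed.

Lemma bracket_additive (s u t : R) : 0 <= s -> s < u -> u < t -> t <= T ->
  bracket W WW s t = bracket W WW s u + bracket W WW u t.
Proof.
move=> s0 su ut tT; have [_ _ /(_ s u t s0 su ut tT) chen] := hW.
apply/matrixP => i j; rewrite /bracket /sym /tensor (incr_split s u t).
move: (incr W s u) (incr W u t) chen => a b chen.
have {}chen i' j' : WW s t i' j' = WW s u i' j' + WW u t i' j' +
    a i' 0 * b j' 0.
  have := congr1 (fun X : 'M[R]_M => X i' j') chen.
  by rewrite /tensor !mxE big_ord1 !mxE => ->; ring.
by rewrite !mxE !big_ord1 !mxE !chen; field.
Qed.

Lemma bracket_bound KW (s t : R) : 0 <= KW -> path_bound KW ->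
  0 <= s -> s < t -> t <= T ->
  `|bracket W WW s t| <= (KW * KW + 2 * KW) * (t - s) `^ (2 * alpha).
Proof.
move=> KW0 bW s0 st tT; have [W1 W2] := bW s t s0 st tT.
have p0 : 0 < t - s by rewrite subr_gt0.
apply: mx_norm_le => [|i j].
  by rewrite mulr_ge0 ?powR_ge0// addr_ge0// mulr_ge0.
rewrite /bracket /sym scalerA divff ?pnatr_eq0// scale1r.
move: (incr W s t) W1 => w W1; rewrite !mxE big_ord1 mxE.
rewrite [leRHS]mulrDl; apply: le_trans (ler_normB _ _) _; apply: lerD.
  rewrite normrM.
  rewrite -powR_square// [leRHS](_ : _ = (KW * (t - s) `^ alpha) * (KW * (t - s) `^ alpha));
    last by ring.
  by apply: ler_pM => //; apply: le_trans (mx_norm_coord _ _ _) W1.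
apply: le_trans (ler_normD _ _) _; rewrite -mulrA mulr2n [leRHS]mulrDl !mul1r.
by apply: lerD; apply: le_trans (mx_norm_coord _ _ _) W2.
Qed.

(** Since the bracket is additive, the defect is - (f_u - f_s) [W]_{u,t}. *)
Lemma young_germ_additive f K KW : 0 <= K -> 0 <= KW -> path_bound KW ->
  integrand_bound f K ->
  almost_additive T (3 * alpha) (M%:R * (M%:R * (K * (KW * KW + 2 * KW))))
    (young_germ f).
Proof.
move=> K0 KW0 bW bf s u t s0 su ut tT.
have u0 : 0 <= u by lra.
have uT : u <= T by lra.
rewrite /young_germ (bracket_additive s0 su ut tT) tapplyDr.
have -> : tapply (f s) (bracket W WW s u) + tapply (f s) (bracket W WW u t) -
    tapply (f s) (bracket W WW s u) - tapply (f u) (bracket W WW u t) =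
    - tapply (fun x y => f u x y - f s x y) (bracket W WW u t).
  by rewrite tapplyBl opprB [X in X - _]addrAC subrr add0r.
rewrite normrN; apply: le_trans (tapply_norm _ (bf s u s0 su uT)) _.
rewrite -!(mulrA M%:R); do 2! apply: ler_wpM2l => //.
have p1 : 0 <= K * (u - s) `^ alpha by rewrite mulr_ge0 ?powR_ge0.
apply: le_trans (ler_wpM2r p1 (bracket_bound KW0 bW u0 ut tT)) _.
rewrite [leLHS](_ : _ = K * (KW * KW + 2 * KW) *
  ((t - u) `^ (2 * alpha) * (u - s) `^ alpha)); last by ring.
apply: ler_wpM2l; first by rewrite mulr_ge0// addr_ge0// mulr_ge0.
by apply: powR_cube_le; lra.
Qed.

Lemma rough_integral_exists
    (Z : R -> 'M[R]_(D, M)) (Z' : R -> 'cV[R]_M -> 'M[R]_(D, M)) (t : R) : 0 <= t <= T ->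
  controlled T alpha enorm W Z Z' ->
  exists I, is_rough_integral W WW Z Z' 0 t I.
Proof.
move=> /andP[t0 tT] /[dup] [[lZ _ _ _]] /controlled_byP[K K0 ctrl].
have [KW KW0 bW] := rough_path_bound.
exact: sewing_limit three_alpha (rough_const_ge0 K0 KW0)
  (rough_germ_additive K0 KW0 bW lZ ctrl) t0 tT.
Qed.

Lemma young_integral_exists (f : R -> 'cV[R]_M -> 'cV[R]_M -> 'cV[R]_D) (t : R) : 0 <= t <= T ->
  young_integrand T alpha f -> exists I, is_young_integral W WW f 0 t I.
Proof.
move=> /andP[t0 tT] /young_integrand_bound[K K0 bf].
have [KW KW0 bW] := rough_path_bound.
apply: sewing_limit three_alpha _ (young_germ_additive K0 KW0 bW bf) t0 tT.
by rewrite !mulr_ge0// addr_ge0// mulr_ge0.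
Qed.

Lemma rough_integral_increment
    (Z : R -> 'M[R]_(D, M)) (Z' : R -> 'cV[R]_M -> 'M[R]_(D, M)) (K KW u v : R) Iu Iv :
  0 <= K -> 0 <= KW -> path_bound KW ->
  (forall t : R, 0 <= t <= T -> linear (Z' t)) -> controlled_by T alpha W Z Z' K ->
  0 <= u -> u < v -> v <= T ->
  is_rough_integral W WW Z Z' 0 u Iu -> is_rough_integral W WW Z Z' 0 v Iv ->
  `|Iv - Iu - rough_germ Z Z' u v| <=
    sewing_const (3 * alpha) * rough_const K KW * (v - u) `^ (3 * alpha).
Proof.
move=> K0 KW0 bW lZ ctrl.
exact: partition_limit_increment three_alpha (rough_const_ge0 K0 KW0)
  (rough_germ_additive K0 KW0 bW lZ ctrl).
Qed.

End Germs.

(** * Jointly continuous families and multilinear bounds *)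

Section JointContinuity.
Context {R : realType} {V W : normedModType R}.
Implicit Types (T : R) (g : R -> V -> W).

Lemma jointly_continuous_sum T n (g : 'I_n -> R -> V -> W) :
  (forall i, jointly_continuous T (g i)) ->
  jointly_continuous T (fun t x => \sum_i g i t x).
Proof.
move=> gc p; apply: cvg_big; first exact: add_continuous.
by move=> i _; exact: gc.
Qed.

Lemma jointly_continuous_norm T g : jointly_continuous T g ->
  jointly_continuous T (fun t x => `|g t x| : R).
Proof. by move=> gc p; apply: cvg_norm; exact: gc. Qed.

Lemma jointly_continuousD T g g' :
  jointly_continuous T g -> jointly_continuous T g' ->
  jointly_continuous T (fun t x => g t x + g' t x).
Proof. by move=> gc gc' p; apply: cvgD; [exact: gc|exact: gc']. Qed.

Lemma jointly_continuousZ T (k : R -> V -> R) g :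
  jointly_continuous T k -> jointly_continuous T g ->
  jointly_continuous T (fun t x => k t x *: g t x).
Proof. by move=> kc gc p; apply: cvgZ; [exact: kc|exact: gc]. Qed.

Lemma jointly_continuous_time T (f : R -> W) : {within `[0, T], continuous f} ->
  jointly_continuous T (fun t (_ : V) => f t).
Proof.
move=> /within_itvP fc; apply/jointly_continuousP => x y xT e e0.
by have [d d0 dP] := fc x xT e e0; exists d => // u z uT ux _; exact: dP.
Qed.

Lemma term_le_sum n (F : 'I_n -> R) i : (forall i, 0 <= F i) -> F i <= \sum_i F i.
Proof. by move=> F0; rewrite (bigD1 i)//= lerDl sumr_ge0. Qed.

End JointContinuity.

Lemma linear_sub (R : realType) (U V : lmodType R) (f : U -> V) a b :
  linear f -> f (a - b) = f a - f b.
Proof.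
by move=> lf; have := lf (-1) b a; rewrite !scaleN1r ![- _ + _]addrC.
Qed.

Section Multilinear.
Context {R : realType} {n : nat} {W : normedModType R}.
Implicit Types (f : 'cV[R]_n -> W).
Local Notation e := (fun i => delta_mx i 0 : 'cV[R]_n).

Lemma iterdiff2_norm f x B a b : smooth f ->
  (forall i j, `|iterdiff f [:: e i; e j] x| <= B) ->
  `|iterdiff f [:: a; b] x| <= n%:R * (n%:R * B * `|a|) * `|b|.
Proof.
move=> sf fB.
apply: (linear_norm (f := fun v => iterdiff f [:: a; v] x)).
  exact: (iterdiff_linear [:: a] [::]).
move=> j; apply: (linear_norm (f := fun v => iterdiff f [:: v; e j] x)) => //.
exact: (iterdiff_linear [::] [:: e j]).
Qed.

Lemma iterdiff3_norm f x B a b c : smooth f ->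
  (forall i j k, `|iterdiff f [:: e i; e j; e k] x| <= B) ->
  `|iterdiff f [:: a; b; c] x| <= n%:R * (n%:R * (n%:R * B * `|a|) * `|b|) * `|c|.
Proof.
move=> sf fB.
apply: (linear_norm (f := fun v => iterdiff f [:: a; b; v] x)).
  exact: (iterdiff_linear [:: a; b] [::]).
move=> k; apply: (linear_norm (f := fun v => iterdiff f [:: a; v; e k] x)).
  exact: (iterdiff_linear [:: a] [:: e k]).
move=> j; apply: (linear_norm (f := fun v => iterdiff f [:: v; e j; e k] x)) => //.
exact: (iterdiff_linear [::] [:: e j; e k]).
Qed.

Lemma iterdiff2_sub f x a b : smooth f ->
  iterdiff f [:: a; a] x - iterdiff f [:: b; b] x =
  iterdiff f [:: a - b; a] x + iterdiff f [:: b; a - b] x.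
Proof.
move=> sf.
have -> := linear_sub a b (@iterdiff_linear _ _ _ f [::] [:: a] x sf).
have -> := linear_sub a b (@iterdiff_linear _ _ _ f [:: b] [::] x sf).
by rewrite addrA subrK.
Qed.

End Multilinear.

Lemma mx_ofE (R : realType) (M D : nat) (f : 'cV[R]_M -> 'cV[R]_D) v :
  linear f -> mx_of f *m v = f v.
Proof.
move=> lf; rewrite (linear_delta v lf); apply/colP => i.
by rewrite mxE summxE; apply: eq_bigr => j _; rewrite !mxE mulrC.
Qed.

Lemma mx_of_delta (R : realType) (M D : nat) (f : 'cV[R]_M -> 'cV[R]_D) j :
  mx_of f *m delta_mx j 0 = f (delta_mx j 0).
Proof. by rewrite -colE; apply/colP => i; rewrite !mxE. Qed.

(** * Germs that do not contribute to the limit *)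

Section Negligible.
Context {R : realType} {V : normedModType R}.
Implicit Types (E Xi : R -> R -> V) (T : R).

(** Germs that are o(v - u), uniformly in u: their Riemann sums tend to 0. *)
Definition negligible T E := forall e : R, 0 < e -> exists2 d : R, 0 < d &
  forall u v : R, 0 <= u -> u < v -> v <= T -> v - u < d ->
    `|E u v| <= e * (v - u).

Lemma negligible_ext T E E' :
  (forall u v : R, 0 <= u -> u < v -> v <= T -> E u v = E' u v) ->
  negligible T E -> negligible T E'.
Proof.
move=> EE' nE e e0; have [d d0 dP] := nE e e0; exists d => // u v u0 uv vT uvd.
by rewrite -EE'//; exact: dP.
Qed.

Lemma negligibleD T E E' : negligible T E -> negligible T E' ->
  negligible T (fun u v => E u v + E' u v).
Proof.
move=> nE nE' e e0; have e20 : 0 < e / 2 by lra.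
have [d d0 dP] := nE _ e20; have [d' d'0 d'P] := nE' _ e20.
exists (Num.min d d'); first by rewrite lt_min d0.
move=> u v u0 uv vT; rewrite lt_min => /andP[ud ud'].
apply: le_trans (ler_normD _ _) _.
by have := dP u v u0 uv vT ud; have := d'P u v u0 uv vT ud'; lra.
Qed.

Lemma negligible_le T (c : R) E E' :
  0 <= c -> (forall u v : R, 0 <= u -> u < v -> v <= T -> `|E' u v| <= c * `|E u v|) ->
  negligible T E -> negligible T E'.
Proof.
move=> c0 EE' nE e e0.
have c10 : 0 < c + 1 by rewrite ltr_wpDl.
have ec : 0 < e / (c + 1) by rewrite divr_gt0.
have [d d0 dP] := nE _ ec; exists d => // u v u0 uv vT uvd.
apply: le_trans (EE' u v u0 uv vT) _.
apply: le_trans (ler_wpM2l c0 (dP u v u0 uv vT uvd)) _.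
rewrite mulrA; apply: ler_wpM2r; first by rewrite subr_ge0 ltW.
by rewrite mulrCA ler_piMr ?(ltW e0)// ler_pdivrMr// mul1r lerDl.
Qed.

Lemma negligibleN T E : negligible T E -> negligible T (fun u v => - E u v).
Proof.
by apply: (@negligible_le _ 1) => // u v _ _ _; rewrite normrN mul1r.
Qed.

Lemma negligibleZ T (c : R) E : negligible T E -> negligible T (fun u v => c *: E u v).
Proof.
by apply: (@negligible_le _ `|c|) => // u v _ _ _; rewrite normrZ.
Qed.

Lemma negligible_powR T (theta C d : R) E : 1 < theta -> 0 <= C -> 0 < d ->
  (forall u v : R, 0 <= u -> u < v -> v <= T -> v - u < d ->
     `|E u v| <= C * (v - u) `^ theta) -> negligible T E.
Proof.
move=> th C0 d0 HE e e0.
have C10 : 0 < C + 1 by rewrite ltr_wpDl.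
have eC : 0 < e / (C + 1) by rewrite divr_gt0.
have [d' d'0 d'P] := superlinear_small th eC.
exists (Num.min d d'); first by rewrite lt_min d0.
move=> u v u0 uv vT; rewrite lt_min => /andP[ud ud'].
have uv0 : 0 < v - u by rewrite subr_gt0.
apply: le_trans (HE u v u0 uv vT ud) _.
apply: le_trans (ler_wpM2l C0 (d'P _ uv0 ud')) _.
rewrite mulrA; apply: ler_wpM2r; first exact: ltW.
by rewrite mulrCA ler_piMr ?(ltW e0)// ler_pdivrMr// mul1r lerDl.
Qed.

Lemma negligible_limit T E (t : R) : 0 <= t <= T -> negligible T E ->
  is_partition_limit 0 t E 0.
Proof.
move=> /andP[t0 tT] nE e e0.
have t10 : 0 < t + 1 by rewrite ltr_wpDl.
have et : 0 < e / (t + 1) by rewrite divr_gt0.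
have [d d0 dP] := nE _ et; exists d => // s [ps /eqP ls] ms.
rewrite subr0 -/(riemann_sum E 0 s).
apply: le_lt_trans (@riemann_sum_mesh_le _ _ E (e / (t + 1)) d 0 s ps ms _) _.
  by move=> u v u0 uv vl uvd; apply: dP => //; apply: le_trans tT; rewrite -ls.
by rewrite ls subr0 mulrAC ltr_pdivrMr// ltr_pM2l// ltrDl.
Qed.

End Negligible.

Section PartitionLimits.
Context {R : realType} {V : normedModType R}.
Implicit Types (Xi : R -> R -> V) (a b : R) (I : V).

Lemma partition_limitD a b Xi Xi' I I' :
  is_partition_limit a b Xi I -> is_partition_limit a b Xi' I' ->
  is_partition_limit a b (fun u v => Xi u v + Xi' u v) (I + I').
Proof.
move=> lI lI' e e0; have e20 : 0 < e / 2 by lra.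
have [d d0 dP] := lI _ e20; have [d' d'0 d'P] := lI' _ e20.
exists (Num.min d d'); first by rewrite lt_min d0.
move=> s Ps ms; rewrite -/(riemann_sum _ a s) riemann_sumD opprD addrACA.
apply: le_lt_trans (ler_normD _ _) _.
have md : mesh_lt d a s by apply: mesh_ltW ms; rewrite ge_min lexx.
have md' : mesh_lt d' a s by apply: mesh_ltW ms; rewrite ge_min lexx orbT.
have := dP s Ps md; have := d'P s Ps md'; rewrite /riemann_sum; lra.
Qed.

Lemma partition_limitZ a b Xi I (c : R) :
  is_partition_limit a b Xi I ->
  is_partition_limit a b (fun u v => c *: Xi u v) (c *: I).
Proof.
move=> lI e e0.
have c10 : 0 < `|c| + 1 by rewrite ltr_wpDl.
have ec : 0 < e / (`|c| + 1) by rewrite divr_gt0.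
have [d d0 dP] := lI _ ec; exists d => // s Ps ms.
have -> : \sum_(x <- pairmap (fun u v => c *: Xi u v) a s) x =
    c *: \sum_(x <- pairmap Xi a s) x.
  rewrite -/(riemann_sum Xi a s) -/(riemann_sum _ a s); elim: (s) (a) => [|x r IH] y.
    by rewrite !riemann_sum_nil scaler0.
  by rewrite !riemann_sum_cons IH scalerDr.
rewrite -scalerBr normrZ.
apply: le_lt_trans (ler_wpM2l (normr_ge0 c) (ltW (dP s Ps ms))) _.
by rewrite mulrCA gtr_pMr// ltr_pdivrMr// mul1r ltrDl.
Qed.

Lemma partition_limit_ext a b Xi Xi' I :
  (forall u v : R, a <= u -> u < v -> v <= b -> Xi u v = Xi' u v) ->
  is_partition_limit a b Xi I -> is_partition_limit a b Xi' I.
Proof.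
move=> XX lI e e0; have [d d0 dP] := lI e e0; exists d => // s Ps ms.
suff -> : \sum_(x <- pairmap Xi' a s) x = \sum_(x <- pairmap Xi a s) x by exact: dP.
case: Ps => ps /eqP ls; rewrite -/(riemann_sum Xi a s) -/(riemann_sum Xi' a s).
clear -XX ps ls; elim: s a XX ps ls => [|x s IH] a XX /=.
  by rewrite !riemann_sum_nil.
move=> /andP[ax ps] ls; rewrite !riemann_sum_cons XX//.
  congr (_ + _); apply: IH => // u v xu; apply: XX; exact: le_trans (ltW ax) xu.
by rewrite -ls path_lt_last_le.
Qed.

Lemma partition_limit_unique a b Xi I I' : a <= b ->
  is_partition_limit a b Xi I -> is_partition_limit a b Xi I' -> I = I'.
Proof.
move=> ab lI lI'; apply/eqP; rewrite -subr_eq0 -normr_le0.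
apply/ler_addgt0Pr => e e0; rewrite add0r; have e20 : 0 < e / 2 by lra.
have [d d0 dP] := lI _ e20; have [d' d'0 d'P] := lI' _ e20.
have dd0 : 0 < Num.min d d' by rewrite lt_min d0.
have [s Ps ms] := fine_partition ab dd0.
have md : mesh_lt d a s by apply: mesh_ltW ms; rewrite ge_min lexx.
have md' : mesh_lt d' a s by apply: mesh_ltW ms; rewrite ge_min lexx orbT.
have := dP s Ps md; have := d'P s Ps md'.
have := ler_distD (riemann_sum Xi a s) I I'.
rewrite -/(riemann_sum Xi a s) (distrC I (riemann_sum Xi a s)); lra.
Qed.

Lemma partition_limit_telescope a b (F : R -> V) :
  is_partition_limit a b (fun u v => F v - F u) (F b - F a).
Proof.
move=> e e0; exists 1 => // s [_ /eqP ls] _.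
by rewrite -/(riemann_sum _ a s) riemann_sum_telescope ls subrr normr0.
Qed.

End PartitionLimits.

Lemma partition_limit_time_integral (R : realType) (D : nat) (f : R -> 'cV[R]_D) (t : R) :
  {within `[0, t], continuous f} ->
  is_partition_limit 0 t (fun u v => time_integral u v f) (time_integral 0 t f).
Proof.
move=> fc; have := partition_limit_telescope 0 t (fun s => time_integral 0 s f).
have -> : time_integral 0 0 f = 0.
  by apply/colP => i; rewrite !mxE set_itv1 Rintegral_set1.
rewrite subr0; apply: partition_limit_ext => u v u0 uv vt.
apply: time_integralB => //; last exact: ltW.
by apply: continuous_subspaceW fc; apply: subset_itvl; rewrite bnd_simp.
Qed.

(** * Local expansion of H(t, Y_t) *)

Section LocalExpansion.
Context {R : realType} {M D : nat}.
Variables (T alpha : R) (W : R -> 'cV[R]_M) (WW : R -> R -> 'M[R]_M).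
Hypotheses (T0 : 0 < T) (a3 : 3^-1 < alpha) (hW : rough_path T alpha W WW).
Variables (eta : R -> 'cV[R]_D -> 'M[R]_(D, M))
          (etadot : R -> 'cV[R]_D -> 'cV[R]_M -> 'M[R]_(D, M))
          (eta0 : R -> 'cV[R]_D -> 'cV[R]_D)
          (H : R -> 'cV[R]_D -> 'cV[R]_D)
          (Y Ups0 : R -> 'cV[R]_D)
          (Ups : R -> 'M[R]_(D, M))
          (Ups' : R -> 'cV[R]_M -> 'M[R]_(D, M)).
Hypotheses
  (heta : forall x, controlled T alpha enorm W (eta^~ x) (etadot^~ x))
  (ha_ctrl : continuous_controlled T alpha enorm W eta etadot)
  (heta0 : jointly_continuous T eta0)
  (hH : forall x t, 0 <= t <= T ->
     is_rough_integral W WW (eta^~ x) (etadot^~ x) 0 t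
       (H t x - H 0 x - time_integral 0 t (eta0^~ x)))
  (hH_smooth : forall t, 0 <= t <= T -> smooth (H t))
  (hH_cont : forall vs : seq 'cV[R]_D, (size vs <= 3)%N ->
     jointly_continuous T (fun t => iterdiff (H t) vs))
  (hUps0 : {within `[0, T], continuous Ups0})
  (hUps : controlled T alpha enorm W Ups Ups')
  (hY_ctrl : controlled T alpha enorm W Y (fun t v => Ups t *m v))
  (hY : forall t, 0 <= t <= T ->
     is_rough_integral W WW Ups Ups' 0 t
       (Y t - Y 0 - time_integral 0 t Ups0))
  (hwp_eta : controlled T alpha enorm W (eta_Y eta Y) (eta_Y' eta etadot Y Ups))
  (hwp_young1 : young_integrand T alpha (Deta_Y' eta Y Ups)).

Let a0 : 0 < alpha. Proof. exact: alpha_gt0 a3. Qed.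
Let th : 1 < 3 * alpha. Proof. exact: three_alpha a3. Qed.
Local Notation e := (fun i => delta_mx i 0 : 'cV[R]_D).

Lemma path_increment_bound : exists2 K : R, 0 <= K &
  forall u v : R, 0 <= u -> u < v -> v <= T ->
    `|Y v - Y u| <= K * (v - u) `^ alpha /\
    `|Y v - Y u - Ups u *m incr W u v| <= K * (v - u) `^ (2 * alpha).
Proof.
case: hY_ctrl => _ /holder_bound[K1 K10 H1] _ /holder_bound[K2 K20 H2].
exists (K1 + K2); first by rewrite addr_ge0.
move=> u v u0 uv vT; split.
  have := H1 u v u0 uv vT; rewrite lee_fin => /le_trans; apply.
  by rewrite ler_wpM2r ?powR_ge0// lerDl.
have := H2 u v u0 uv vT; rewrite lee_fin => /le_trans; apply.
by rewrite ler_wpM2r ?powR_ge0// lerDr.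
Qed.

Lemma path_continuous : {within `[0, T], continuous Y}.
Proof.
have [K K0 HK] := path_increment_bound.
by apply: (holder_path_continuous (K := K) a0) => s t s0 st tT; case: (HK s t s0 st tT).
Qed.

Lemma along_path_bounded (V : normedModType R) (g : R -> 'cV[R]_D -> V) :
  jointly_continuous T g ->
  exists2 C : R, 0 <= C & forall u : R, 0 <= u <= T -> `|g u (Y u)| <= C.
Proof.
move=> gc; have [C C0 [d d0 dP]] := joint_bounded gc path_continuous.
exists C => // u uT; have := dP u u uT uT _ 0; rewrite !subrr normr0 scaler0 addr0.
by apply => //; rewrite lexx ler01.
Qed.

Lemma dH_bounded : exists2 B : R, 0 <= B &
  forall (u : R) v, 0 <= u <= T -> `|'d (H u) (Y u) v| <= B * `|v|.
Proof.
have gc : jointly_continuous T (fun t x => \sum_i `|iterdiff (H t) [:: e i] x| : R).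
  by apply: jointly_continuous_sum => i; apply: jointly_continuous_norm; exact: hH_cont.
have [C C0 CP] := along_path_bounded gc.
exists (D%:R * C); first by rewrite mulr_ge0.
move=> u v uT; apply: linear_norm; first exact: linearP.
move=> j; apply: le_trans (CP u uT); apply: le_trans (ler_norm _).
exact: (term_le_sum (F := fun i => `|iterdiff (H u) [:: e i] (Y u)|)).
Qed.

Lemma d2H_bounded : exists2 B : R, 0 <= B &
  forall (u : R) v w, 0 <= u <= T -> `|iterdiff (H u) [:: v; w] (Y u)| <= B * `|v| * `|w|.
Proof.
have gc : jointly_continuous T
    (fun t x => \sum_i \sum_j `|iterdiff (H t) [:: e i; e j] x| : R).
  do 2! (apply: jointly_continuous_sum => ?); apply: jointly_continuous_norm.
  exact: hH_cont.
have [C C0 CP] := along_path_bounded gc.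
exists (D%:R * (D%:R * C)); first by rewrite !mulr_ge0.
move=> u v w uT.
apply: le_trans (@iterdiff2_norm _ _ _ (H u) (Y u) C v w (hH_smooth uT) _) _.
  move=> i j; apply: le_trans (CP u uT); apply: le_trans (ler_norm _).
  apply: le_trans (term_le_sum (F := fun i => \sum_j `|iterdiff (H u) [:: e i; e j] (Y u)|) i _).
    exact: (term_le_sum (F := fun j => `|iterdiff (H u) [:: e i; e j] (Y u)|)).
  by move=> k; rewrite sumr_ge0.
by rewrite !mulrA.
Qed.

(** A bound on the third derivatives in basis directions near the compact curve
of the points (u, Y_u) makes the Taylor remainder O(|Y_v - Y_u|^3). *)
Lemma taylor_negligible : negligible T (fun u v =>
  H u (Y v) - H u (Y u) - 'd (H u) (Y u) (Y v - Y u)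
  - 2^-1 *: iterdiff (H u) [:: Y v - Y u; Y v - Y u] (Y u)).
Proof.
have gc : jointly_continuous T (fun t x =>
    \sum_i \sum_j \sum_k `|iterdiff (H t) [:: e i; e j; e k] x| : R).
  do 3! (apply: jointly_continuous_sum => ?); apply: jointly_continuous_norm.
  exact: hH_cont.
have [C C0 [d d0 CP]] := joint_bounded gc path_continuous.
have [K K0 HK] := path_increment_bound.
apply: (negligible_powR (C := D%:R * (D%:R * (D%:R * C * K) * K) * K) th _ d0).
  by rewrite !mulr_ge0.
move=> u v u0 uv vT uvd.
have [hK _] := HK u v u0 uv vT.
have uT : 0 <= u <= T by lra.
have vT' : 0 <= v <= T by lra.
have p0 : 0 < v - u by lra.
set h := Y v - Y u in hK *.
have -> : Y v = Y u + h by rewrite /h addrC subrK.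
apply: taylor3; first exact: hH_smooth.
move=> t t01.
apply: le_trans (@iterdiff3_norm _ _ _ (H u) (Y u + t *: h) C h h h (hH_smooth uT) _) _.
  move=> i j k; have uvd' : `|u - v| < d by rewrite distrC gtr0_norm.
  apply: le_trans (CP u v uT vT' uvd' t t01); apply: le_trans (ler_norm _).
  pose F i j k := `|iterdiff (H u) [:: e i; e j; e k] (Y u + t *: h)|.
  have F0 i' j' k' : 0 <= F i' j' k' by exact: normr_ge0.
  apply: le_trans (term_le_sum (F := fun i => \sum_j \sum_k F i j k) i _).
    apply: le_trans (term_le_sum (F := fun j => \sum_k F i j k) j _).
      exact: (term_le_sum (F := fun k => F i j k)).
    by move=> ?; rewrite sumr_ge0.
  by move=> ?; rewrite sumr_ge0// => ? _; rewrite sumr_ge0.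
rewrite -powR_cube// -powR_square//.
set p := (v - u) `^ alpha in hK *.
rewrite [leRHS](_ : _ = D%:R * (D%:R * (D%:R * C * (K * p)) * (K * p)) * (K * p));
  last by ring.
have n0 := normr_ge0 h.
have s1 : D%:R * C * `|h| <= D%:R * C * (K * p) by rewrite ler_wpM2l ?mulr_ge0.
have s2 : D%:R * (D%:R * C * `|h|) * `|h| <= D%:R * (D%:R * C * (K * p)) * (K * p).
  apply: ler_pM => //; last exact: ler_wpM2l.
  by do ! apply: mulr_ge0.
apply: ler_pM => //; last exact: ler_wpM2l.
by do ! apply: mulr_ge0.
Qed.

(** Y is controlled, so its increment differs from Y'_u W_{u,v} by O(p^2), while
both are O(p). *)
Lemma square_negligible : negligible T (fun u v =>
  iterdiff (H u) [:: Y v - Y u; Y v - Y u] (Y u)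
  - iterdiff (H u) [:: Ups u *m incr W u v; Ups u *m incr W u v] (Y u)).
Proof.
have [B B0 BP] := d2H_bounded.
have [K K0 HK] := path_increment_bound.
pose P := T `^ alpha.
apply: (negligible_powR (C := B * K * K + B * (K + K * P) * K) (d := 1) th) => //.
  by rewrite addr_ge0// !mulr_ge0// addr_ge0// mulr_ge0// powR_ge0.
move=> u v u0 uv vT _.
have [hK rK] := HK u v u0 uv vT.
have uT : 0 <= u <= T by lra.
have p0 : 0 < v - u by lra.
have pP : (v - u) `^ alpha <= P by apply: ge0_ler_powR; rewrite ?nnegrE ?(ltW a0)//; lra.
set h := Y v - Y u in hK rK *; set k := Ups u *m _ in rK *.
rewrite (iterdiff2_sub _ _ _ (hH_smooth uT)).
rewrite -powR_cube// -powR_square// in rK *.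
set p := (v - u) `^ alpha in hK rK pP *.
have p00 : 0 <= p by exact: powR_ge0.
have kK : `|k| <= (K + K * P) * p.
  have -> : k = h - (h - k) by rewrite opprB addrC subrK.
  apply: le_trans (ler_normB _ _) _; rewrite mulrDl; apply: lerD => //.
  apply: le_trans rK _; rewrite -!mulrA ler_wpM2l// mulrC ler_wpM2r//.
apply: le_trans (ler_normD _ _) _; rewrite mulrDl; apply: lerD.
  apply: le_trans (BP u _ _ uT) _.
  rewrite [leRHS](_ : _ = B * (K * (p * p)) * (K * p)); last by ring.
  by apply: ler_pM => //; [rewrite mulr_ge0|rewrite ler_wpM2l].
apply: le_trans (BP u _ _ uT) _.
rewrite [leRHS](_ : _ = B * ((K + K * P) * p) * (K * (p * p))); last by ring.
by apply: ler_pM => //; [rewrite mulr_ge0|rewrite ler_wpM2l].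
Qed.

(** For each r the path F r solves an equation with drift f(., Y_r) and rough
integrand Z r, all with the same constant K; hence r may be the right endpoint
v. The sewing estimate controls the rough part, and continuity of f the drift.
Both H(., Y_v) and Y itself are of this form. *)
Lemma increment_negligible (F : R -> R -> 'cV[R]_D)
   (f : R -> 'cV[R]_D -> 'cV[R]_D)
   (Z : R -> R -> 'M[R]_(D, M)) (Z' : R -> R -> 'cV[R]_M -> 'M[R]_(D, M)) (K : R) :
  0 <= K -> jointly_continuous T f ->
  (forall r t : R, 0 <= r <= T -> 0 <= t <= T -> linear (Z' r t)) ->
  (forall r : R, 0 <= r <= T -> controlled_by T alpha W (Z r) (Z' r) K) ->
  (forall r t : R, 0 <= r <= T -> 0 <= t <= T ->
    is_rough_integral W WW (Z r) (Z' r) 0 t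
      (F r t - F r 0 - time_integral 0 t (fun s => f s (Y r)))) ->
  negligible T (fun u v =>
    F v v - F v u - (v - u) *: f u (Y u) - rough_germ W WW (Z v) (Z' v) u v).
Proof.
move=> K0 fc lZ ctrl int.
have [KW KW0 bW] := rough_path_bound hW.
have fYc (r : R) : {within `[0, T], continuous (fun s => f s (Y r))}.
  apply: (joint_path_continuous fc (Y := fun=> Y r)).
  by move=> ?; exact: cvg_cst.
pose E1 u v := F v v - F v u - time_integral u v (fun s => f s (Y v))
  - rough_germ W WW (Z v) (Z' v) u v.
pose E2 u v := time_integral u v (fun s => f s (Y v)) - (v - u) *: f u (Y u).
apply: (@negligible_ext _ _ _ (fun u v => E1 u v + E2 u v)).
  move=> u v _ _ _; rewrite /E1 /E2.
  by apply/colP => i; rewrite !mxE; ring.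
apply: negligibleD.
  apply: (negligible_powR (C := sewing_const (3 * alpha) * @rough_const R M K KW) (d := 1) th) => //.
    by apply: mulr_ge0; [exact: sewing_const_ge0|exact: rough_const_ge0].
  move=> u v u0 uv vT _.
  have uT : 0 <= u <= T by lra.
  have vT' : 0 <= v <= T by lra.
  have := rough_integral_increment a3 hW K0 KW0 bW (fun t => lZ v t vT') (ctrl v vT')
    u0 uv vT (int v u vT' uT) (int v v vT' vT').
  congr (`|_| <= _).
  rewrite /E1 -(time_integralB (f := fun s => f s (Y v)) _ u0 (ltW uv)); last first.
    by apply: continuous_subspaceW (fYc v); apply: subset_itvl; rewrite bnd_simp.
  by apply/colP => i; rewrite !mxE; ring.
move=> ep ep0; have [d d0 dP] := joint_uniform fc path_continuous ep0.
exists d => // u v u0 uv vT uvd.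
apply: time_integral_close => //; [|exact: ltW|exact: ltW|].
  apply: continuous_subspaceW (fYc v).
  by apply: subset_itv; rewrite bnd_simp.
move=> s us; apply: (dP u v) => //; first exact: ltW.
by rewrite (ltW uv) lexx.
Qed.

(** The controlled seminorm of eta(., x) is locally bounded in x, hence bounded
on the compact set Y([0, T]). *)
Lemma field_controlled_along_path : exists2 K : R, 0 <= K &
  forall r : R, 0 <= r <= T ->
    controlled_by T alpha W (eta^~ (Y r)) (etadot^~ (Y r)) K.
Proof.
pose Q (C u v : R) := controlled_by T alpha W (eta^~ (Y u)) (etadot^~ (Y u)) C.
have [||C [d d0 CP]] := @diagonal_uniform R T Q.
- move=> C C' u v CC' HC s t s0 st tT; have [A B] := HC s t s0 st tT.
  by split=> [j|]; [apply: le_trans (A j) _|apply: le_trans B _];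
    rewrite ler_wpM2r ?powR_ge0.
- move=> x xT.
  have [K K0 /nbhs_ballP[d d0 dP]] := controlled_locally_bounded T0 heta ha_ctrl (Y x).
  have /within_itvP/(_ x xT d d0)[d' d'0 d'P] := path_continuous.
  exists K, d' => // u v uT _ ux _; apply: dP.
  by rewrite -ball_normE /ball_ /= distrC; exact: d'P.
exists `|C|; first exact: normr_ge0.
move=> r rT s t s0 st tT.
have rr : `|r - r| < d by rewrite subrr normr0.
have [A B] := CP r r rT rT rr s t s0 st tT.
by split=> [j|]; [apply: le_trans (A j) _|apply: le_trans B _];
  rewrite ler_wpM2r ?powR_ge0// ler_norm.
Qed.

Lemma field_increment_negligible : negligible T (fun u v =>
  H v (Y v) - H u (Y v) - (v - u) *: eta0 u (Y u)
  - rough_germ W WW (eta^~ (Y v)) (etadot^~ (Y v)) u v).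
Proof.
have [K K0 ctrl] := field_controlled_along_path.
apply: (increment_negligible (F := fun r t => H t (Y r))
  (Z := fun r => eta^~ (Y r)) (Z' := fun r => etadot^~ (Y r)) K0 heta0) => //.
  by move=> r t _ tT; case: (heta (Y r)) => + _ _ _; apply.
by move=> r t _; exact: hH.
Qed.

Lemma path_increment_negligible : negligible T (fun u v =>
  Y v - Y u - (v - u) *: Ups0 u - rough_germ W WW Ups Ups' u v).
Proof.
have [K K0 ctrl] := controlled_byP hUps.
apply: (increment_negligible (F := fun _ => Y) (f := fun s _ => Ups0 s)
  (Z := fun=> Ups) (Z' := fun=> Ups') K0) => //.
- exact: jointly_continuous_time.
- by move=> r t _; case: hUps => + _ _ _; apply.
- by move=> r t _; exact: hY.
Qed.

Lemma dH_path_negligible : negligible T (fun u v =>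
  'd (H u) (Y u) (Y v - Y u) - (v - u) *: 'd (H u) (Y u) (Ups0 u)
  - 'd (H u) (Y u) (Ups u *m incr W u v)
  - tapply (fun x y => 'd (H u) (Y u) (Ups' u x *m y)) (WW u v)).
Proof.
have [B B0 BP] := dH_bounded.
apply: (negligible_le B0) path_increment_negligible => u v u0 uv vT.
have uT : 0 <= u <= T by lra.
rewrite -[in leLHS]linearZ /=.
have -> : tapply (fun x y => 'd (H u) (Y u) (Ups' u x *m y)) (WW u v) =
    'd (H u) (Y u) (tapply (fun x y => Ups' u x *m y) (WW u v)).
  rewrite /tapply linear_sum; apply: eq_bigr => i _; rewrite linear_sum.
  by apply: eq_bigr => j _; rewrite linearZ.
rewrite -!linearB /rough_germ opprD addrA.
exact: BP.
Qed.

(** D_x eta(s, Y_s) Y'_s and the Gubinelli derivative of eta(., Y) are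
alpha-Hoelder in time, hence so is their difference s |-> etadot(s, Y_s). The
time increment of etadot at the frozen point Y_v is O(p) as well, and what is
left is the increment in space. Smoothness of eta(t, .) alone would give no
rate here, because it is not uniform in t. *)
Lemma etadot_space_holder : exists2 K : R, 0 <= K &
  forall u v : R, 0 <= u -> u < v -> v <= T -> forall j,
    `|etadot u (Y v) (delta_mx j 0) - etadot u (Y u) (delta_mx j 0)|
      <= K * (v - u) `^ alpha.
Proof.
have [K1 K10 ctrl1] := field_controlled_along_path.
have [K2 K20 ctrl2] := controlled_byP hwp_eta.
have [K3 K30 HK3] := young_integrand_bound hwp_young1.
exists (K1 + K2 + K3); first by rewrite !addr_ge0.
move=> u v u0 uv vT j.
have vT' : 0 <= v <= T by lra.
have [/(_ j) A1 _] := ctrl1 v vT' u v u0 uv vT.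
have [/(_ j) A2 _] := ctrl2 u v u0 uv vT.
have A3 : `|'d (eta v) (Y v) (Ups v *m delta_mx j 0)
            - 'd (eta u) (Y u) (Ups u *m delta_mx j 0)| <= K3 * (v - u) `^ alpha.
  apply: mx_norm_le => [|k l]; first by rewrite mulr_ge0 ?powR_ge0.
  apply: le_trans (HK3 u v u0 uv vT j l).
  rewrite /Deta_Y' -mulmxBl; move: (_ - _) => A; rewrite -colE.
  by apply: le_trans (mx_norm_coord _ k 0); rewrite [col _ _ _ _]mxE.
have -> : etadot u (Y v) (delta_mx j 0) - etadot u (Y u) (delta_mx j 0) =
  - (etadot v (Y v) (delta_mx j 0) - etadot u (Y v) (delta_mx j 0))
  + (eta_Y' eta etadot Y Ups v (delta_mx j 0) - eta_Y' eta etadot Y Ups u (delta_mx j 0))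
  - ('d (eta v) (Y v) (Ups v *m delta_mx j 0)
     - 'd (eta u) (Y u) (Ups u *m delta_mx j 0)).
  have alg (a b c d1 d2 : 'M[R]_(D, M)) :
      a - b = - (c - a) + (c + d1 - (b + d2)) - (d1 - d2).
    by apply/matrixP => k l; rewrite !mxE; ring.
  exact: alg.
rewrite !mulrDl; apply: le_trans (ler_normB _ _) _; apply: lerD => //.
by apply: le_trans (ler_normD _ _) _; rewrite normrN; apply: lerD.
Qed.

(** The increment of eta(., Y) is the increment in time at the frozen point Y_v
plus the increment in space at time u; both the former and the sum have
controlled expansions, whose difference is the expansion of the latter. *)
Lemma field_along_path_negligible : negligible T (fun u v =>
  rough_germ W WW (eta^~ (Y v)) (etadot^~ (Y v)) u v
  - rough_germ W WW (eta^~ (Y u)) (etadot^~ (Y u)) u v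
  - 'd (eta u) (Y u) (Ups u *m incr W u v) *m incr W u v).
Proof.
have [K1 K10 ctrl1] := field_controlled_along_path.
have [K2 K20 ctrl2] := controlled_byP hwp_eta.
have [K3 K30 HK3] := etadot_space_holder.
have [KW KW0 bW] := rough_path_bound hW.
pose C := M%:R * ((K1 + K2 + M%:R * K3 * KW) * KW) + M%:R * (M%:R * (KW * (M%:R * K3))).
apply: (negligible_powR (C := C) (d := 1) th) => //.
  by rewrite /C; do ! (apply: addr_ge0 || apply: mulr_ge0).
move=> u v u0 uv vT _.
have uT : 0 <= u <= T by lra.
have vT' : 0 <= v <= T by lra.
have p0 : 0 < v - u by lra.
have [w1 X2] := bW u v u0 uv vT.
have [_ R1] := ctrl1 v vT' u v u0 uv vT.
have [_ R2] := ctrl2 u v u0 uv vT.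
have {}HK3 := HK3 u v u0 uv vT.
set w := incr W u v in w1 *.
rewrite -/w in R1 R2.
have lin x : linear (etadot u x) by case: (heta x) => + _ _ _; apply.
pose G x := etadot u (Y v) x - etadot u (Y u) x.
have linG : linear G.
  by move=> a x y; rewrite /G !lin; apply/matrixP => k l; rewrite !mxE; ring.
(* Below S is eta(u, Y_v) - eta(u, Y_u) - D_x eta(u, Y_u) k, written as a difference
   of two controlled remainders and the increment of etadot in space. *)
pose S := (eta_Y eta Y v - eta_Y eta Y u - eta_Y' eta etadot Y Ups u w)
  - (eta v (Y v) - eta u (Y v) - etadot u (Y v) w) - G w.
have -> : rough_germ W WW (eta^~ (Y v)) (etadot^~ (Y v)) u v
  - rough_germ W WW (eta^~ (Y u)) (etadot^~ (Y u)) u v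
  - 'd (eta u) (Y u) (Ups u *m w) *m w
  = S *m w + tapply (fun x y => G x *m y) (WW u v).
  have -> : tapply (fun x y => G x *m y) (WW u v) =
    tapply (fun x y => etadot u (Y v) x *m y) (WW u v)
    - tapply (fun x y => etadot u (Y u) x *m y) (WW u v).
    by rewrite -tapplyBl; apply: eq_tapply => i j; rewrite /G mulmxBl.
  have -> : S = eta u (Y v) - eta u (Y u) - 'd (eta u) (Y u) (Ups u *m w).
    have alg (a b c d x y : 'M[R]_(D, M)) :
        b - a - (x + d) - (b - c - y) - (y - x) = c - a - d.
      by apply/matrixP => k l; rewrite !mxE; ring.
    exact: alg.
  have alg (a b c x y : 'cV[R]_D) : a + x - (b + y) - c = a - b - c + (x - y).
    by apply/colP => k; rewrite !mxE; ring.
  rewrite !mulmxBl; exact: alg.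
rewrite -powR_cube// -powR_square// in R1 R2 X2 *.
set p := (v - u) `^ alpha in R1 R2 X2 w1 HK3 *.
have pp0 : 0 <= p by exact: powR_ge0.
have SK : `|S| <= (K1 + K2 + M%:R * K3 * KW) * (p * p).
  have GK : `|G w| <= M%:R * (K3 * p) * (KW * p).
    apply: le_trans (linear_norm w linG HK3) _.
    by apply: ler_wpM2l => //; do ! apply: mulr_ge0.
  rewrite /S; apply: le_trans (ler_normB _ _) _; rewrite mulrDl; apply: lerD.
    by apply: le_trans (ler_normB _ _) _; rewrite addrC mulrDl; apply: lerD.
  by apply: le_trans GK _; rewrite le_eqVlt; apply/orP; left; apply/eqP; ring.
rewrite /C mulrDl; apply: le_trans (ler_normD _ _) _; apply: lerD.
  apply: le_trans (mulmx_norm _ _) _; rewrite -!mulrA; apply: ler_wpM2l => //.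
  apply: le_trans (ler_pM _ _ SK w1) _ => //.
  by rewrite le_eqVlt; apply/orP; left; apply/eqP; ring.
apply: le_trans (@tapply_norm _ _ _ _ _ (M%:R * (K3 * p)) _) _.
  move=> i j; apply: le_trans (mulmx_norm _ _) _.
  rewrite -[leRHS]mulr1; apply: ler_pM => //; last exact: delta_norm.
  by apply: ler_wpM2l => //; exact: HK3.
rewrite -!(mulrA M%:R); do 2! apply: ler_wpM2l => //.
apply: le_trans (ler_wpM2r _ X2) _; first by do ! apply: mulr_ge0.
by rewrite le_eqVlt; apply/orP; left; apply/eqP; ring.
Qed.

Definition drift (s : R) (y : 'cV[R]_D) : 'cV[R]_D :=
  eta0 s y + 'd (H s) y (Ups0 s).

Lemma drift_continuous : jointly_continuous T drift.
Proof.
rewrite (_ : drift = fun t x => eta0 t x +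
    \sum_j Ups0 t j 0 *: iterdiff (H t) [:: e j] x).
  apply: jointly_continuousD => //; apply: jointly_continuous_sum => j.
  apply: jointly_continuousZ; last exact: hH_cont.
  apply: jointly_continuous_time => x.
  by apply: (continuous_cvg _ (@coord_continuous _ _ _ j 0 _)); exact: hUps0.
apply/funext => t; apply/funext => x; rewrite /drift; congr (_ + _).
exact: (linear_delta (f := 'd (H t) x) (Ups0 t) (linearP _)).
Qed.

Lemma drift_path_continuous : {within `[0, T], continuous (fun s => drift s (Y s))}.
Proof. exact: joint_path_continuous drift_continuous path_continuous. Qed.

Lemma drift_negligible : negligible T (fun u v =>
  time_integral u v (fun s => drift s (Y s)) - (v - u) *: drift u (Y u)).
Proof.
move=> ep ep0; have [d d0 dP] := joint_uniform drift_continuous path_continuous ep0.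
exists d => // u v u0 uv vT uvd.
apply: time_integral_close => //; [|exact: ltW|exact: ltW|].
  apply: continuous_subspaceW drift_path_continuous.
  by apply: subset_itv; rewrite bnd_simp.
by move=> s us; apply: (dP u v) => //; exact: ltW.
Qed.

Definition composed_germ (u v : R) : 'cV[R]_D :=
  rough_germ W WW (fun s => eta_Y eta Y s + DH_Ups H Y Ups s)
    (fun s v => eta_Y' eta etadot Y Ups s v + DH_Ups' eta H Y Ups Ups' s v) u v
  + young_germ W WW (Deta_Y' eta Y Ups) u v
  + 2^-1 *: young_germ W WW (D2H_Y'Y' H Y Ups) u v.

(** Against WW the rough germ contracts b(v, w) + b(w, v), where
b(v, w) = (D_x eta Y'v) w, and D_x^2 H(Y'v, Y'w). The bracket germs contain
their negatives, and b and D_x^2 H / 2 evaluated on the increments of W. The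
factor 1/2 in front of the last bracket suffices because D_x^2 H is
symmetric. *)
Lemma composed_germE (u v : R) : 0 <= u <= T ->
  composed_germ u v =
    rough_germ W WW (eta^~ (Y u)) (etadot^~ (Y u)) u v
    + 'd (H u) (Y u) (Ups u *m incr W u v)
    + tapply (fun x y => 'd (H u) (Y u) (Ups' u x *m y)) (WW u v)
    + 'd (eta u) (Y u) (Ups u *m incr W u v) *m incr W u v
    + 2^-1 *: iterdiff (H u) [:: Ups u *m incr W u v; Ups u *m incr W u v] (Y u).
Proof.
move=> uT.
pose b1 (x y : 'cV[R]_M) := 'd (eta u) (Y u) (Ups u *m x) *m y.
pose b2 (x y : 'cV[R]_M) := iterdiff (H u) [:: Ups u *m x; Ups u *m y] (Y u).
have sH := hH_smooth uT.
have lUps (V : lmodType R) (f : 'cV[R]_D -> V) : linear f ->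
    linear (fun x : 'cV[R]_M => f (Ups u *m x)).
  by move=> lf a x y; rewrite linearP lf.
have [b1r b1l] := mulmx_bilinear (lUps _ _ (linearP ('d (eta u) (Y u)))).
have b2r x : linear (b2 x).
  apply: (lUps _ (fun z => iterdiff (H u) [:: Ups u *m x; z] (Y u))).
  exact: (iterdiff_linear [:: Ups u *m x] [::]).
have b2l y : linear (b2^~ y).
  apply: (lUps _ (fun z => iterdiff (H u) [:: z; Ups u *m y] (Y u))).
  exact: (iterdiff_linear [::] [:: Ups u *m y]).
have b2C : tapply (fun x y => b2 y x) (WW u v) = tapply b2 (WW u v).
  by apply: eq_tapply => i j; exact: second_derivative_symmetric.
rewrite /composed_germ /young_germ.
rewrite -[Deta_Y' eta Y Ups u]/b1 -[D2H_Y'Y' H Y Ups u]/b2.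
rewrite !tapply_bracket// b2C /rough_germ mulmxDl.
have -> : DH_Ups H Y Ups u *m incr W u v = 'd (H u) (Y u) (Ups u *m incr W u v).
  by rewrite /DH_Ups mx_ofE//; apply: lUps; exact: linearP.
have -> : tapply (fun x y => (eta_Y' eta etadot Y Ups u x
      + DH_Ups' eta H Y Ups Ups' u x) *m y) (WW u v) =
    tapply (fun x y => etadot u (Y u) x *m y) (WW u v) + tapply b1 (WW u v)
    + (tapply (fun x y => b1 y x) (WW u v) + tapply b2 (WW u v)
       + tapply (fun x y => 'd (H u) (Y u) (Ups' u x *m y)) (WW u v)).
  rewrite -!tapplyDl; apply: eq_tapply => i j.
  by rewrite /eta_Y' /DH_Ups' mulmxDl mulmxDl mx_of_delta.
rewrite /eta_Y -[iterdiff _ _ _]/(b2 _ _) -['d (eta u) _ _ *m _]/(b1 _ _).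
have alg (a c x1 x2 t0 t1 t2 t3 t4 : 'cV[R]_D) :
    a + c + (t0 + t1 + (t2 + t3 + t4)) + (x1 - (t1 + t2))
      + 2^-1 *: (x2 - (t3 + t3)) = a + t0 + c + t4 + x1 + 2^-1 *: x2.
  by apply/colP => k; rewrite !mxE; field.
exact: alg.
Qed.

Lemma composed_increment_negligible : negligible T (fun u v =>
  H v (Y v) - H u (Y u) -
  (composed_germ u v + time_integral u v (fun s => drift s (Y s)))).
Proof.
apply: negligible_ext (negligibleD (negligibleD (negligibleD (negligibleD (negligibleD
  taylor_negligible (negligibleZ 2^-1 square_negligible)) dH_path_negligible)
  field_increment_negligible) field_along_path_negligible)
  (negligibleN drift_negligible)) => u v u0 uv vT.
have uT : 0 <= u <= T by lra.
rewrite composed_germE// /drift.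
have alg (hvv huv huu dh d2h d2k dU dk t c gv gu x I : 'cV[R]_D) (r : R) :
    huv - huu - dh - 2^-1 *: d2h + 2^-1 *: (d2h - d2k)
    + (dh - r *: dU - dk - t) + (hvv - huv - r *: c - gv) + (gv - gu - x)
    - (I - r *: (c + dU)) =
    hvv - huu - (gu + dk + t + x + 2^-1 *: d2k + I).
  by apply/colP => k; rewrite !mxE; field.
exact: alg.
Qed.

End LocalExpansion.

(** * The Ito-Wentzell formula *)

Lemma rough_germD (R : realType) (M D : nat) (W : R -> 'cV[R]_M)
    (WW : R -> R -> 'M[R]_M) (Z1 Z2 : R -> 'M[R]_(D, M))
    (Z1' Z2' : R -> 'cV[R]_M -> 'M[R]_(D, M)) (u v : R) :
  rough_germ W WW (fun s => Z1 s + Z2 s) (fun s x => Z1' s x + Z2' s x) u v =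
  rough_germ W WW Z1 Z1' u v + rough_germ W WW Z2 Z2' u v.
Proof.
rewrite /rough_germ mulmxDl addrACA -tapplyDl; congr (_ + _).
by apply: eq_tapply => i j; rewrite mulmxDl.
Qed.

Lemma weakly_geometric_bracket (R : realType) (M : nat) (T : R)
    (W : R -> 'cV[R]_M) (WW : R -> R -> 'M[R]_M) :
  weakly_geometric T W WW -> forall s u : R, 0 <= s -> s < u -> u <= T ->
  bracket W WW s u = 0.
Proof.
move=> geo s u s0 su uT; rewrite /bracket geo// scalerA divff ?pnatr_eq0//.
by rewrite scale1r subrr.
Qed.

Lemma young_integral_geometric (R : realType) (M D : nat) (T : R)
    (W : R -> 'cV[R]_M) (WW : R -> R -> 'M[R]_M)
    (f : R -> 'cV[R]_M -> 'cV[R]_M -> 'cV[R]_D) (t : R) I :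
  weakly_geometric T W WW -> 0 <= t <= T -> is_young_integral W WW f 0 t I -> I = 0.
Proof.
move=> geo tT intI; have t0 : 0 <= t by lra.
apply: (partition_limit_unique t0 intI); apply: (negligible_limit tT).
move=> e e0; exists 1 => // u v u0 uv vT _.
rewrite (weakly_geometric_bracket geo u0 uv vT) -[0 : 'M[R]_M](subrr 0) tapplyDr.
by rewrite tapplyNr subrr normr0 mulr_ge0// ?subr_ge0 ltW.
Qed.

Unset Implicit Arguments.

Theorem theorem4p6 (R : realType) (M D : nat) (T alpha : R)
  (hT : 0 < T) (halpha : 3^-1 < alpha <= 2^-1)
  (W : R -> 'cV[R]_M) (WW : R -> R -> 'M[R]_M)
  (hW : rough_path T alpha W WW)
  (eta : R -> 'cV[R]_D -> 'M[R]_(D, M))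
  (etadot : R -> 'cV[R]_D -> 'cV[R]_M -> 'M[R]_(D, M))
  (Deta' : R -> 'cV[R]_D -> 'cV[R]_M -> 'cV[R]_D -> 'M[R]_(D, M))
  (heta : forall x, controlled T alpha enorm W (eta^~ x) (etadot^~ x))
  (ha_ctrl : continuous_controlled T alpha enorm W eta etadot)
  (ha_cont : jointly_continuous T eta)
  (ha_smooth : forall t, 0 <= t <= T -> smooth (eta t))
  (hb_cont : forall y, jointly_continuous T (fun t x => 'd (eta t) x y))
  (hb_smooth : forall t, 0 <= t <= T ->
     forall y, smooth (fun x => 'd (eta t) x y))
  (hc_lin : forall t x v, 0 <= t <= T -> linear (Deta' t x v))
  (hc : forall x, controlled T alpha (opnorm enorm) W
     (fun t => 'd (eta t) x : 'cV[R]_D -> 'M[R]_(D, M)) (Deta'^~ x))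
  (hc_ctrl : continuous_controlled T alpha (opnorm enorm) W
     (fun t x => 'd (eta t) x : 'cV[R]_D -> 'M[R]_(D, M)) Deta')
  (eta0 : R -> 'cV[R]_D -> 'cV[R]_D)
  (heta0_cont : jointly_continuous T eta0)
  (heta0_smooth : forall t, 0 <= t <= T -> smooth (eta0 t))
  (H : R -> 'cV[R]_D -> 'cV[R]_D)
  (hH_ctrl : forall x, controlled T alpha enorm W (H^~ x)
     (fun t v => eta t x *m v))
  (hH : forall x t, 0 <= t <= T ->
     is_rough_integral W WW (eta^~ x) (etadot^~ x) 0 t
       (H t x - H 0 x - time_integral 0 t (eta0^~ x)))
  (hH_smooth : forall t, 0 <= t <= T -> smooth (H t))
  (hH_cont : forall vs : seq 'cV[R]_D, (size vs <= 3)%N ->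
     jointly_continuous T (fun t => iterdiff (H t) vs))
  (Y : R -> 'cV[R]_D) (Ups0 : R -> 'cV[R]_D)
  (Ups : R -> 'M[R]_(D, M)) (Ups' : R -> 'cV[R]_M -> 'M[R]_(D, M))
  (hUps0 : {within `[0, T], continuous Ups0})
  (hUps : controlled T alpha enorm W Ups Ups')
  (hY_ctrl : controlled T alpha enorm W Y (fun t v => Ups t *m v))
  (hY : forall t, 0 <= t <= T ->
     is_rough_integral W WW Ups Ups' 0 t
       (Y t - Y 0 - time_integral 0 t Ups0))
  (hwp_eta : controlled T alpha enorm W (eta_Y eta Y) (eta_Y' eta etadot Y Ups))
  (hwp_DH : controlled T alpha enorm W (DH_Ups H Y Ups) (DH_Ups' eta H Y Ups Ups'))
  (hwp_young1 : young_integrand T alpha (Deta_Y' eta Y Ups))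
  (hwp_young2 : young_integrand T alpha (D2H_Y'Y' H Y Ups)) :
  forall t, 0 <= t <= T ->
  exists I1 I3 I4 : 'cV[R]_D,
    [/\ is_rough_integral W WW
          (fun s => eta_Y eta Y s + DH_Ups H Y Ups s)
          (fun s v => eta_Y' eta etadot Y Ups s v + DH_Ups' eta H Y Ups Ups' s v)
          0 t I1,
        is_young_integral W WW (Deta_Y' eta Y Ups) 0 t I3,
        is_young_integral W WW (D2H_Y'Y' H Y Ups) 0 t I4,
        H t (Y t) =
          H 0 (Y 0) + I1
          + time_integral 0 t
              (fun s => eta0 s (Y s) + 'd (H s) (Y s) (Ups0 s))
          + I3 + 2^-1 *: I4 &
        weakly_geometric T W WW ->
          [/\ forall s u, 0 <= s -> s < u -> u <= T -> bracket W WW s u = 0,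
              I3 = 0, I4 = 0 &
              H t (Y t) =
                H 0 (Y 0) + I1
                + time_integral 0 t
                    (fun s => eta0 s (Y s) + 'd (H s) (Y s) (Ups0 s))]].
Proof.
move=> t tT; have [t0 tleT] : 0 <= t /\ t <= T by lra.
have [a3 _] := andP halpha.
have [Ia intIa] := rough_integral_exists a3 hW tT hwp_eta.
have [Ib intIb] := rough_integral_exists a3 hW tT hwp_DH.
have [I3 intI3] := young_integral_exists a3 hW tT hwp_young1.
have [I4 intI4] := young_integral_exists a3 hW tT hwp_young2.
have intI1 : is_rough_integral W WW
    (fun s => eta_Y eta Y s + DH_Ups H Y Ups s)
    (fun s v => eta_Y' eta etadot Y Ups s v + DH_Ups' eta H Y Ups Ups' s v)
    0 t (Ia + Ib).
  apply: partition_limit_ext (partition_limitD intIa intIb) => u v _ _ _.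
  exact: esym (rough_germD W WW (eta_Y eta Y) (DH_Ups H Y Ups)
    (eta_Y' eta etadot Y Ups) (DH_Ups' eta H Y Ups Ups') u v).
have driftc := drift_path_continuous a3 heta0_cont hH_cont hUps0 hY_ctrl.
have intT := partition_limit_time_integral
  (continuous_subspaceW (subset_itvl (tleT : (BRight t <= BRight T)%O)) driftc).
have small := negligible_limit tT (composed_increment_negligible hT a3 hW heta ha_ctrl
  heta0_cont hH hH_smooth hH_cont hUps0 hUps hY_ctrl hY hwp_eta hwp_young1).
have main : H t (Y t) - H 0 (Y 0) =
    Ia + Ib + I3 + 2^-1 *: I4
    + time_integral 0 t (fun s => drift eta0 H Ups0 s (Y s)).
  apply: (partition_limit_unique t0 (partition_limit_telescope 0 t (fun s => H s (Y s)))).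
  have := partition_limitD small (partition_limitD
    (partition_limitD (partition_limitD intI1 intI3) (partition_limitZ 2^-1 intI4)) intT).
  by rewrite add0r; apply: partition_limit_ext => u v _ _ _; rewrite subrK.
have formula : H t (Y t) = H 0 (Y 0) + (Ia + Ib)
    + time_integral 0 t (fun s => eta0 s (Y s) + 'd (H s) (Y s) (Ups0 s))
    + I3 + 2^-1 *: I4.
  rewrite -[LHS](subrK (H 0 (Y 0))) main /drift.
  move: (time_integral _ _ _) => I2.
  by rewrite [LHS]addrC !addrA [LHS](ACl (1*2*3*6*4*5)).
exists (Ia + Ib), I3, I4; split => //.
move=> geo.
have I30 := young_integral_geometric geo tT intI3.
have I40 := young_integral_geometric geo tT intI4.
split=> //; first exact: weakly_geometric_bracket geo.
by rewrite [LHS]formula I30 I40 scaler0 !addr0.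
Qed.
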